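(* Let $\ell,\mathbf{d}\in\mathbb{C}$. The $\widehat{H}_4$-module $V_{\widehat{H}_4}(\ell,\mathbf{d})$ is irreducible if and only if $\ell\neq 0$. Furthermore, if $\ell=0$, then the irreducible quotient of $V_{\widehat{H}_4}(\ell,\mathbf{d})$ is isomorphic to the one-dimensional $\widehat{H}_4$-module $\mathbb{C}v_{\mathbf{d}}$.
   Context: The Nappi-Witten Lie algebra is the 4-dimensional complex Lie algebra $H_4=\mathbb{C}a\oplus\mathbb{C}b\oplus\mathbb{C}c\oplus\mathbb{C}d$ with brackets $[a,b]=c$, $[d,a]=a$, $[d,b]=-b$, $[c,d]=[c,a]=[c,b]=0$, equipped with the symmetric invariant bilinear form given by $(a,b)=1$, $(c,d)=1$ and all other pairings of basis vectors $0$. The affine Nappi-Witten algebra is $\widehat{H}_4=H_4\otimes\mathbb{C}[t,t^{-1}]\oplus\mathbb{C}\mathbf{k}$ with $[h_1\otimes t^m,h_2\otimes t^n]=[h_1,h_2]\otimes t^{m+n}+m(h_1,h_2)\delta_{m+n,0}\mathbf{k}$ and $\mathbf{k}$ central; $H_4$ is identified with $H_4\otimes t^0$. Put $\widehat{H}_4^{(+)}=\bigoplus_{n>0}H_4\otimes t^n$ and $\widehat{H}_4^{(\geq 0)}=\widehat{H}_4^{(+)}\oplus H_4\oplus\mathbb{C}\mathbf{k}$. For $\mathbf{d}\in\mathbb{C}$, let $L(\mathbf{d})=\mathbb{C}v_{\mathbf{d}}$ be the one-dimensional $H_4$-module with $av_{\mathbf{d}}=bv_{\mathbf{d}}=cv_{\mathbf{d}}=0$,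 $dv_{\mathbf{d}}=\mathbf{d}v_{\mathbf{d}}$. Regard it as an $\widehat{H}_4^{(\geq 0)}$-module with $\widehat{H}_4^{(+)}$ acting as $0$ and $\mathbf{k}$ acting as $\ell$, and set $V_{\widehat{H}_4}(\ell,\mathbf{d})=U(\widehat{H}_4)\otimes_{U(\widehat{H}_4^{(\geq 0)})}\mathbb{C}v_{\mathbf{d}}$, where $U(\cdot)$ denotes the universal enveloping algebra. In the case $\ell=0$, the one-dimensional $\widehat{H}_4$-module $\mathbb{C}v_{\mathbf{d}}$ is the one on which $h\otimes t^n$ ($h\in H_4$, $n\neq 0$), $\mathbf{k}$, $a$, $b$, $c$ act as $0$ and $d$ acts as the scalar $\mathbf{d}$.
   Formalization: For ℓ=0, ''the irreducible quotient'' is taken as the quotient by the largest proper graded submodule (v_d in degree 0, h⊗t^m of degree −m), since without the grading V(0,d) has several non-isomorphic irreducible quotients. *)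

(* Defs.v *)
From HB Require Import structures.
From mathcomp Require Import all_boot all_order all_algebra finmap.
From mathcomp.multinomials Require Import monalg.
From mathcomp Require Import boolp classical_sets reals.
From mathcomp Require Import complex ring.

Set Implicit Arguments.
Unset Strict Implicit.
Unset Printing Implicit Defensive.

Import Order.TTheory GRing.Theory Num.Theory.
Local Open Scope quotient_scope.
Local Open Scope ring_scope.

HB.mixin Record Lmodule_isLieAlgebra (F : numFieldType) L
    of GRing.Lmodule F L := {
  lie : L -> L -> L;
  lie_linearl : forall y, linear (lie^~ y);
  lie_linearr : forall x, linear (lie x);
  lie_alt : forall x, lie x x = 0;
  lie_jacobi : forall x y z,
    lie x (lie y z) + lie y (lie z x) + lie z (lie x y) = 0
}.

#[short(type="lieAlgType")]
HB.structure Definition LieAlgebra (F : numFieldType) :=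
  {L of GRing.Lmodule F L & Lmodule_isLieAlgebra F L}.

(* A Lie algebra with a symmetric invariant bilinear form. *)
HB.mixin Record LieAlgebra_isQuadratic (F : numFieldType) L
    of LieAlgebra F L := {
  iform : L -> L -> F;
  iform_linear : forall y, linear (iform^~ y : L -> F^o);
  iformC : forall x y, iform x y = iform y x;
  iform_inv : forall x y z, iform (lie x y) z = iform x (lie y z)
}.

#[short(type="quadLieAlgType")]
HB.structure Definition QuadLieAlgebra (F : numFieldType) :=
  {L of LieAlgebra F L & LieAlgebra_isQuadratic F L}.

Record lieHom (F : numFieldType) (L L' : lieAlgType F) := LieHom {
  lhom_fun :> {linear L -> L'};
  lhom_lie : forall x y, lhom_fun (lie x y) = lie (lhom_fun x) (lhom_fun y)
}.

Record lieModule (F : numFieldType) (L : lieAlgType F) := LieModule {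
  lmod_sort :> lmodType F;
  lact : L -> lmod_sort -> lmod_sort;
  lact_linearl : forall v, linear (lact^~ v);
  lact_linearr : forall x, linear (lact x);
  lact_lie : forall x y v,
    lact (lie x y) v = lact x (lact y v) - lact y (lact x v)
}.

Section LieTheory.
Variables (F : numFieldType) (L : lieAlgType F).
Implicit Types x y z : L.

HB.instance Definition _ x := GRing.isLinear.Build F L L _ (lie x) (lie_linearr x).

Lemma lieC x y : lie x y = - lie y x.
Proof.
have lieDl u v w : lie (u + v) w = lie u w + lie v w :> L.
  by have := lie_linearl w 1 u v; rewrite !scale1r.
have := lie_alt (x + y); rewrite lieDl !raddfD /= !lie_alt add0r addr0.
by move/eqP; rewrite addr_eq0 => /eqP.
Qed.

Lemma lie0r x : lie x 0 = 0. Proof. exact: linear0. Qed.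
Lemma lie0l x : lie 0 x = 0. Proof. by rewrite lieC lie0r oppr0. Qed.

Variable M : lieModule L.

HB.instance Definition _ x :=
  GRing.isLinear.Build F M M _ (lact x) (@lact_linearr _ _ M x).

Lemma lactDl x y (v : M) : lact (x + y) v = lact x v + lact y v.
Proof. by have := lact_linearl v 1 x y; rewrite !scale1r. Qed.
Lemma lact0l (v : M) : lact 0 v = 0.
Proof. by apply: (addrI (lact 0 v)); rewrite -lactDl !addr0. Qed.
Lemma lactZl a x (v : M) : lact (a *: x) v = a *: lact x v.
Proof. by have := lact_linearl v a x 0; rewrite lact0l !addr0. Qed.
End LieTheory.

Definition lie_isomorphic (F : numFieldType) (L : lieAlgType F)
    (M N : lieModule L) : Prop :=
  exists f : {linear M -> N},
    bijective f /\ forall x v, f (lact x v) = lact x (f v).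

Section Affinization.
Variables (F : numFieldType) (g : quadLieAlgType F).
Implicit Types (c : F) (f h : {malg g[int]}) (x y z : g) (m n p : int).

(* g (x) F[t, t^-1] is encoded as the finitely supported functions int -> g, the
   monomial << x *g m >> standing for x (x) t^m. *)
Definition laurent_scale c f : {malg g[int]} :=
  \sum_(m <- msupp f) << c *: f@_m *g m >>.

Lemma laurent_scaleE c f m : (laurent_scale c f)@_m = c *: f@_m.
Proof.
rewrite /laurent_scale raddf_sum /=.
rewrite (eq_bigr (fun k => (c *: f@_k) *+ (k == m))); last first.
  by move=> k _; rewrite mcoeffU.
have [mf|mf] := boolP (m \in msupp f).
  rewrite (big_fsetD1 _ mf) /= eqxx mulr1n big_seq big1 ?addr0 // => k.
  by rewrite !inE => /andP[/negPf->].
rewrite (mcoeff_outdom mf) scaler0 big_seq big1 // => k kf.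
have [km|] := eqVneq k m; last by [].
by move: kf; rewrite km (negPf mf).
Qed.

Definition laurent : Type := {malg g[int]}.
HB.instance Definition _ := GRing.Zmodule.on laurent.

Fact laurent_scaleA c c' f :
  laurent_scale c (laurent_scale c' f) = laurent_scale (c * c') f.
Proof. by apply/malgP => m; rewrite !laurent_scaleE scalerA. Qed.
Fact laurent_scale1 f : laurent_scale 1 f = f.
Proof. by apply/malgP => m; rewrite laurent_scaleE scale1r. Qed.
Fact laurent_scaleDr c : {morph laurent_scale c : f h / f + h}.
Proof. by move=> f h; apply/malgP => m; rewrite mcoeffD !laurent_scaleE mcoeffD scalerDr. Qed.
Fact laurent_scaleDl f : {morph laurent_scale^~ f : c c' / c + c'}.
Proof. by move=> c c'; apply/malgP => m; rewrite mcoeffD !laurent_scaleE scalerDl. Qed.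
HB.instance Definition _ := GRing.Zmodule_isLmodule.Build F laurent
  laurent_scaleA laurent_scale1 laurent_scaleDr laurent_scaleDl.

Lemma laurent_coefZ c (f : laurent) m :
  ((c *: f : laurent) : {malg g[int]})@_m = c *: (f : {malg g[int]})@_m.
Proof. exact: laurent_scaleE. Qed.

Lemma laurent_monomZ c x m :
  (<< c *: x *g m >> : {malg g[int]}) = c *: (<< x *g m >> : laurent).
Proof.
by apply/malgP => n; rewrite laurent_coefZ !mcoeffU; case: eqP; rewrite ?scaler0.
Qed.

Lemma sum_msuppw (V : zmodType) (G : int -> g -> V) f (D : {fset int}) :
  (forall m, G m 0 = 0) -> (msupp f `<=` D)%fset ->
  \sum_(m <- msupp f) G m f@_m = \sum_(m <- D) G m f@_m.
Proof.
move=> G0 fD; rewrite (big_fset_incl _ fD) // => m _.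
by move/mcoeff_outdom ->.
Qed.

Lemma sum_msupp_linear (V : lmodType F) (G : int -> g -> V) :
  (forall m, linear (G m)) ->
  linear ((fun f => \sum_(m <- msupp f) G m f@_m) : laurent -> V).
Proof.
move=> Glin c f h; have G0 m : G m 0 = 0.
  by have := Glin m (-1) 0 0; rewrite scaler0 addr0 scaleN1r addNr.
set D := (msupp (c *: f + h : laurent) `|` (msupp f `|` msupp h))%fset.
have fD : (msupp f `<=` D)%fset by rewrite fsubsetU // fsubsetUl orbT.
have hD : (msupp h `<=` D)%fset by rewrite fsubsetU // fsubsetUr orbT.
rewrite !(@sum_msuppw _ _ _ D) ?fsubsetUl // scaler_sumr.
rewrite -big_split /=; apply: eq_bigr => m _.
by rewrite mcoeffD laurent_coefZ Glin.
Qed.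

Lemma sum_msuppU (V : zmodType) (G : int -> g -> V) x m :
  (forall m, G m 0 = 0) ->
  \sum_(k <- msupp << x *g m >>) G k << x *g m >>@_k = G m x.
Proof.
move=> G0; rewrite (@sum_msuppw _ _ _ [fset m]%fset) ?msuppU_le //.
by rewrite big_seq_fset1 mcoeffUU.
Qed.

Definition affine : Type := (laurent * F^o)%type.
HB.instance Definition _ := GRing.Lmodule.on affine.

Definition loop x m : affine := (<< x *g m >>, 0).
Definition central : affine := (0, 1).

(* Bilinear extension of [x t^m, y t^n] = [x, y] t^(m+n) + m (x, y) delta_(m+n,0) k
   with k = central; see affine_lie_loop. *)
Definition affine_lie (u v : affine) : affine :=
  (\sum_(m <- msupp u.1) \sum_(n <- msupp v.1)
     << lie u.1@_m v.1@_n *g m + n >>,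
   \sum_(m <- msupp u.1) m%:~R * iform u.1@_m v.1@_(- m)).

Fact affine_lie_linearl (v : affine) : linear (affine_lie^~ v).
Proof.
move=> c u w; rewrite /affine_lie; congr (_, _).
  have G : forall m, linear (fun x : g => \sum_(n <- msupp v.1)
      << lie x v.1@_n *g m + n >> : laurent).
    move=> m c' x y; rewrite scaler_sumr -big_split /=; apply: eq_bigr => n _.
    by rewrite lie_linearl -laurent_monomZ -monalgUD.
  exact: (sum_msupp_linear G).
have G : forall m, linear (fun x : g => m%:~R * iform x v.1@_(- m) : F^o).
  move=> m c' x y; rewrite (iform_linear _ c' x y) mulrDr; congr (_ + _).
  exact: mulrCA.
exact: (sum_msupp_linear G).
Qed.

Lemma iform_linearr (x : g) : linear (iform x : g -> F^o).
Proof. by move=> c y z; rewrite iformC iform_linear !(iformC x). Qed.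

Fact affine_lie_linearr (u : affine) : linear (affine_lie u).
Proof.
move=> c v w; rewrite /affine_lie; congr (_, _); rewrite /= scaler_sumr.
  rewrite -big_split /=; apply: eq_bigr => m _.
  have G : forall n, linear (fun y : g => << lie u.1@_m y *g m + n >> : laurent).
    by move=> n c' x y; rewrite lie_linearr -laurent_monomZ -monalgUD.
  exact: (sum_msupp_linear G).
rewrite -big_split /=; apply: eq_bigr => m _.
rewrite mcoeffD laurent_coefZ iform_linearr mulrDr; congr (_ + _).
exact: mulrCA.
Qed.

Lemma iform0l y : iform 0 y = 0 :> F.
Proof.
have := iform_linear y (-1) 0 0.
by rewrite scaler0 addr0 scaleN1r addNr.
Qed.
Lemma iform0r y : iform y 0 = 0 :> F.
Proof. by rewrite iformC iform0l. Qed.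

Lemma loopD x y m : loop (x + y) m = loop x m + loop y m.
Proof. by rewrite /loop monalgUD; congr (_, _); rewrite addr0. Qed.
Lemma loop0 m : loop 0 m = 0.
Proof. by rewrite /loop monalgU0. Qed.
Lemma loopN x m : loop (- x) m = - loop x m.
Proof. by apply: (addrI (loop x m)); rewrite -loopD !subrr loop0. Qed.

Lemma affine_lie_loop x y m n :
  affine_lie (loop x m) (loop y n) =
  loop (lie x y) (m + n)
    + (if m + n == 0 then m%:~R * iform x y else 0) *: central.
Proof.
rewrite /affine_lie /= (@sum_msuppU _ (fun m x => \sum_(k <- msupp << y *g n >>)
  << lie x << y *g n >>@_k *g m + k >>)); last first.
  by move=> k; rewrite big1 // => i _; rewrite lie0l monalgU0.
rewrite (@sum_msuppU _ (fun n y => << lie x y *g m + n >>)); last first.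
  by move=> k; rewrite lie0r monalgU0.
rewrite (@sum_msuppU _ (fun m x => m%:~R * iform x << y *g n >>@_(- m))); last first.
  by move=> k; rewrite iform0l mulr0.
rewrite mcoeffU /loop /central; congr (_, _); rewrite /= ?scaler0 ?addr0 //.
rewrite add0r addr_eq0 -[m == _]eqr_oppLR eq_sym.
by case: eqP => _; rewrite /= ?mulr1n ?mulr0n ?iform0r /GRing.scale /= ?mulr1 ?mulr0.
Qed.

Lemma affineE (u : affine) :
  u = (\sum_(m <- msupp u.1) loop u.1@_m m) + u.2 *: central.
Proof.
case: u => f c; rewrite [RHS]surjective_pairing; congr (_, _).
  by rewrite /= raddf_sum /= scaler0 addr0 -monalgE.
by rewrite /= raddf_sum /= big1 // add0r /GRing.scale /= mulr1.
Qed.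

Lemma affine_ind (P : affine -> Prop) :
  (forall u v, P u -> P v -> P (u + v)) ->
  (forall x m, P (loop x m)) -> (forall c, P (c *: central)) ->
  forall u, P u.
Proof.
move=> PD Pl Pc u; rewrite [u]affineE.
apply: (PD) => //; apply: big_ind => //.
by rewrite -(scale0r central).
Qed.

Fact affine_lie0l v : affine_lie 0 v = 0.
Proof.
have := affine_lie_linearl v (-1) 0 0.
by rewrite scaler0 addr0 scaleN1r addNr.
Qed.
Fact affine_lie0r v : affine_lie v 0 = 0.
Proof.
have := affine_lie_linearr v (-1) 0 0.
by rewrite scaler0 addr0 scaleN1r addNr.
Qed.
Fact affine_lieDl u v w : affine_lie (u + v) w = affine_lie u w + affine_lie v w.
Proof. by have := affine_lie_linearl w 1 u v; rewrite !scale1r. Qed.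
Fact affine_lieDr u v w : affine_lie w (u + v) = affine_lie w u + affine_lie w v.
Proof. by have := affine_lie_linearr w 1 u v; rewrite !scale1r. Qed.
Fact affine_lie_centrall c u : affine_lie (c *: central) u = 0.
Proof. by rewrite /affine_lie /= scaler0 msupp0 !big_seq_fset0. Qed.
Fact affine_lie_centralr c u : affine_lie u (c *: central) = 0.
Proof.
rewrite /affine_lie /= scaler0 msupp0; congr (_, _); rewrite big1 // => m _.
  by rewrite big_seq_fset0.
by rewrite mcoeff0 iform0r mulr0.
Qed.

Fact affine_lieC u v : affine_lie u v = - affine_lie v u.
Proof.
elim/affine_ind: u => [u1 u2 h1 h2|x m|c].
- by rewrite affine_lieDl affine_lieDr h1 h2 opprD.
- elim/affine_ind: v => [u1 u2 h1 h2|y n|c].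
  + by rewrite affine_lieDl affine_lieDr h1 h2 opprD.
  + rewrite !affine_lie_loop [n + m]addrC opprD -scaleNr; congr (_ + _ *: _).
      by rewrite lieC loopN.
    case: eqP => [/eqP|]; rewrite ?oppr0 // addr_eq0 => /eqP ->.
    by rewrite iformC rmorphN mulNr.
  + by rewrite affine_lie_centralr affine_lie_centrall oppr0.
- by rewrite affine_lie_centralr affine_lie_centrall oppr0.
Qed.

Fact affine_lie_alt u : affine_lie u u = 0.
Proof.
apply/eqP; have /eqP := affine_lieC u u.
rewrite -addr_eq0 -mulr2n -scaler_nat scaler_eq0.
by rewrite (negPf (lt0r_neq0 (ltr0Sn F 1))).
Qed.

Fact affine_lie_jacobi u v w :
  affine_lie u (affine_lie v w) + affine_lie v (affine_lie w u)
  + affine_lie w (affine_lie u v) = 0.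
Proof.
have addE (p q r p' q' r' : affine) : p + q + r = 0 -> p' + q' + r' = 0 ->
  (p + p') + (q + q') + (r + r') = 0.
  by move=> h h'; rewrite (addrACA p) (addrACA (p + q)) h h' addr0.
elim/affine_ind: u => [u1 u2 h1 h2|x m|c].
- by rewrite !(affine_lieDl, affine_lieDr); apply: addE.
- elim/affine_ind: v => [u1 u2 h1 h2|y n|c].
  + by rewrite !(affine_lieDl, affine_lieDr); apply: addE.
  + elim/affine_ind: w => [u1 u2 h1 h2|z p|c].
    * by rewrite !(affine_lieDl, affine_lieDr); apply: addE.
    * rewrite !affine_lie_loop !affine_lieDr !affine_lie_centralr !addr0.
      rewrite !affine_lie_loop.
      have -> : n + (p + m) = m + (n + p) by rewrite addrA addrC.
      have -> : p + (m + n) = m + (n + p) by rewrite addrC addrA.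
      apply: addE; first by rewrite -!loopD lie_jacobi loop0.
      have -> : iform y (lie z x) = iform x (lie y z).
        by rewrite -iform_inv iformC.
      have -> : iform z (lie x y) = iform x (lie y z).
        by rewrite iformC iform_inv.
      rewrite -!scalerDl; case: eqP => [mnp0|_]; last by rewrite !addr0 scale0r.
      by rewrite -!mulrDl -!rmorphD /= -addrA mnp0 mul0r scale0r.
    * by rewrite !(affine_lie_centralr, affine_lie_centrall,
                   affine_lie0r, affine_lie0l) !addr0.
  + by rewrite !(affine_lie_centralr, affine_lie_centrall,
                 affine_lie0r, affine_lie0l) !addr0.
- by rewrite !(affine_lie_centralr, affine_lie_centrall,
               affine_lie0r, affine_lie0l) !addr0.
Qed.

HB.instance Definition _ := Lmodule_isLieAlgebra.Build F affine
  affine_lie_linearl affine_lie_linearr affine_lie_alt affine_lie_jacobi.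

Definition aff_ge0 : {pred affine} :=
  fun u => all (fun m => 0 <= m) (msupp u.1).

Lemma aff_ge0P (u : affine) :
  reflect (forall m, m < 0 -> u.1@_m = 0) (u \in aff_ge0).
Proof.
apply: (iffP allP) => [h m m0|h m].
  by apply/mcoeff_outdom/negP => /h; rewrite leNgt m0.
by rewrite -mcoeff_neq0 leNgt; apply: contraNN => /h ->.
Qed.

Fact aff_ge0_submod : submod_closed aff_ge0.
Proof.
split=> [|c u v /aff_ge0P hu /aff_ge0P hv].
  by apply/aff_ge0P => m _; rewrite mcoeff0.
apply/aff_ge0P => m m0.
by rewrite /= mcoeffD laurent_coefZ hu // hv // scaler0 addr0.
Qed.
HB.instance Definition _ := GRing.isSubmodClosed.Build F affine aff_ge0
  aff_ge0_submod.

Record affine_ge0 := AffineGe0 { ge0_val :> affine; _ : ge0_val \in aff_ge0 }.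
HB.instance Definition _ := [isSub for ge0_val].
HB.instance Definition _ := [Choice of affine_ge0 by <:].
HB.instance Definition _ := [SubChoice_isSubLmodule of affine_ge0 by <:].

Lemma loop_ge0 x m : 0 <= m -> loop x m \in aff_ge0.
Proof.
move=> m0; apply/aff_ge0P => n n0; rewrite mcoeffU.
by case: eqP => // mn; move: n0; rewrite -mn ltNge m0.
Qed.

Lemma central_ge0 : central \in aff_ge0.
Proof. by apply/aff_ge0P => m _; rewrite mcoeff0. Qed.

Fact aff_ge0_lie u v : u \in aff_ge0 -> v \in aff_ge0 -> lie u v \in aff_ge0.
Proof.
move=> /allP hu /allP hv.
have -> : (lie u v \in aff_ge0) = (\sum_(m <- msupp u.1)
    \sum_(n <- msupp v.1) loop (lie u.1@_m v.1@_n) (m + n) \in aff_ge0).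
  rewrite !unfold_in; congr (all _ (msupp _)); rewrite raddf_sum; apply: eq_bigr => m _.
  by rewrite raddf_sum.
rewrite big_seq rpred_sum // => m mu; rewrite big_seq rpred_sum // => n nv.
by rewrite loop_ge0 // addr_ge0 //; [exact: hu | exact: hv].
Qed.

Definition ge0_lie (u v : affine_ge0) : affine_ge0 :=
  AffineGe0 (aff_ge0_lie (valP u) (valP v)).

Lemma ge0_valP c (u v : affine_ge0) :
  ge0_val (c *: u + v) = c *: ge0_val u + ge0_val v.
Proof. by []. Qed.

Fact ge0_lie_linearl v : linear (ge0_lie^~ v).
Proof. by move=> c u w; apply: val_inj; exact: lie_linearl. Qed.
Fact ge0_lie_linearr u : linear (ge0_lie u).
Proof. by move=> c v w; apply: val_inj; exact: lie_linearr. Qed.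
Fact ge0_lie_alt u : ge0_lie u u = 0.
Proof. by apply: val_inj; exact: lie_alt. Qed.
Fact ge0_lie_jacobi u v w :
  ge0_lie u (ge0_lie v w) + ge0_lie v (ge0_lie w u) + ge0_lie w (ge0_lie u v) = 0.
Proof. by apply: val_inj; exact: lie_jacobi. Qed.
HB.instance Definition _ := Lmodule_isLieAlgebra.Build F affine_ge0
  ge0_lie_linearl ge0_lie_linearr ge0_lie_alt ge0_lie_jacobi.

Definition ge0_incl : lieHom affine_ge0 affine :=
  @LieHom F affine_ge0 affine (val : {linear affine_ge0 -> affine})
    (fun _ _ => erefl).

Section Inflate.
Variables (W : lieModule g) (l : F).

(* x (x) t^m acts as 0 for m > 0 and as x for m = 0; k acts as l. *)
Definition ge0_act (u : affine_ge0) (w : W) : W :=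
  lact (ge0_val u).1@_0 w + (l * (ge0_val u).2) *: w.

Fact ge0_act_linearl w : linear (ge0_act^~ w).
Proof.
move=> c u v; rewrite /ge0_act /= mcoeffD laurent_coefZ.
rewrite lactDl lactZl scalerDr addrACA; congr (_ + _).
by rewrite mulrDr scalerDl mulrCA scalerA.
Qed.
Fact ge0_act_linearr u : linear (ge0_act u).
Proof.
move=> c v w; rewrite /ge0_act lact_linearr !scalerDr addrACA.
by rewrite !scalerA [c * _]mulrC.
Qed.

Fact ge0_act_lie (u v : affine_ge0) w :
  ge0_act (lie u v) w = ge0_act u (ge0_act v w) - ge0_act v (ge0_act u w).
Proof.
have hu := aff_ge0P _ (valP u); have hv := aff_ge0P _ (valP v).
have lie1 : (ge0_val (lie u v)).1@_0
    = lie (ge0_val u).1@_0 (ge0_val v).1@_0.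
  have h0 (f : {malg g[int]}) (G : int -> g -> g) :
      (forall m, m != 0 -> G m f@_m = 0) -> G 0 0 = 0 ->
      \sum_(m <- msupp f) G m f@_m = G 0 f@_0.
    move=> Gm G0; have [f0|f0] := boolP (0 \in msupp f).
      by rewrite (big_fsetD1 _ f0) /= big_seq big1 ?addr0 // => m;
         rewrite !inE => /andP[m0 _]; exact: Gm.
    rewrite (mcoeff_outdom f0) G0 big_seq big1 // => m mf.
    by apply: Gm; apply: contraNneq f0 => <-.
  rewrite [LHS]/= raddf_sum /=.
  rewrite (h0 _ (fun m x => (\sum_(n <- msupp (ge0_val v).1)
    << lie x (ge0_val v).1@_n *g m + n >>)@_0)) /=.
  - rewrite raddf_sum /= (h0 _ (fun n y =>
      << lie (ge0_val u).1@_0 y *g 0 + n >>@_0)).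
    + by rewrite addr0 mcoeffUU.
    + by move=> m m0; rewrite mcoeffU add0r (negPf m0).
    + by rewrite lie0r monalgU0 mcoeff0.
  - move=> m m0; rewrite raddf_sum big1 //= => n _; rewrite mcoeffU.
    case: eqP => // mn; case: (ltgtP m 0) m0 => // m0 _.
      by rewrite hu // lie0l.
    have -> : n = - m by rewrite -(addKr m n) mn addr0.
    by rewrite hv ?oppr_lt0 // lie0r.
  - by rewrite big1 ?mcoeff0 // => n _; rewrite lie0l monalgU0.
have lie2 : (ge0_val (lie u v)).2 = 0.
  rewrite /= big1 // => m _.
  case: (ltgtP m 0) => [m0|m0|->].
  - by rewrite hu // iform0l mulr0.
  - by rewrite hv ?oppr_lt0 // iform0r mulr0.
  - by rewrite mul0r.
rewrite /ge0_act lie1 lie2 mulr0 scale0r addr0 lact_lie.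
rewrite !(linearD (lact _)) !(linearZ_LR (lact _)) /= !scalerDr !scalerA.
rewrite [l * _ * (l * (ge0_val u).2)]mulrC.
have abelE (a b p q r : W) : a - b = a + p + (q + r) - (b + q + (p + r)).
  by rewrite -(addrA a) -(addrA b) (addrCA q) opprD addrACA subrr addr0.
exact: abelE.
Qed.

Definition ge0_mod : lieModule affine_ge0 :=
  LieModule ge0_act_linearl ge0_act_linearr ge0_act_lie.
End Inflate.

End Affinization.

Section EnvelopingAlgebra.
Variables (F : numFieldType) (L : lieAlgType F).

(* U(L) is the quotient of the tensor algebra of L by x y - y x = [x, y], presented
   by generators and relations: terms in the elements of L and the scalars, modulo
   the congruence generated by the laws of unital associative F-algebras, the
   linearity of L -> U(L), and the commutator relation. *)
Inductive env_term : Type :=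
  | EnvGen of L
  | EnvConst of F
  | EnvAdd of env_term & env_term
  | EnvMul of env_term & env_term.

Inductive env_eq : env_term -> env_term -> Prop :=
  | env_refl s : env_eq s s
  | env_sym s t : env_eq s t -> env_eq t s
  | env_trans t s u : env_eq s t -> env_eq t u -> env_eq s u
  | env_add s s' t t' :
      env_eq s s' -> env_eq t t' -> env_eq (EnvAdd s t) (EnvAdd s' t')
  | env_mul s s' t t' :
      env_eq s s' -> env_eq t t' -> env_eq (EnvMul s t) (EnvMul s' t')
  | env_addA s t u : env_eq (EnvAdd s (EnvAdd t u)) (EnvAdd (EnvAdd s t) u)
  | env_addC s t : env_eq (EnvAdd s t) (EnvAdd t s)
  | env_add0 s : env_eq (EnvAdd (EnvConst 0) s) s
  | env_addN s : env_eq (EnvAdd (EnvMul (EnvConst (-1)) s) s) (EnvConst 0)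
  | env_mulA s t u : env_eq (EnvMul s (EnvMul t u)) (EnvMul (EnvMul s t) u)
  | env_mul1 s : env_eq (EnvMul (EnvConst 1) s) s
  | env_mulDl s t u :
      env_eq (EnvMul (EnvAdd s t) u) (EnvAdd (EnvMul s u) (EnvMul t u))
  | env_mulDr s t u :
      env_eq (EnvMul u (EnvAdd s t)) (EnvAdd (EnvMul u s) (EnvMul u t))
  | env_constD a b : env_eq (EnvConst (a + b)) (EnvAdd (EnvConst a) (EnvConst b))
  | env_constM a b : env_eq (EnvConst (a * b)) (EnvMul (EnvConst a) (EnvConst b))
  | env_constC a s : env_eq (EnvMul (EnvConst a) s) (EnvMul s (EnvConst a))
  | env_gen_linear a x y :
      env_eq (EnvGen (a *: x + y))
             (EnvAdd (EnvMul (EnvConst a) (EnvGen x)) (EnvGen y))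
  | env_gen_lie x y :
      env_eq (EnvMul (EnvGen x) (EnvGen y))
             (EnvAdd (EnvMul (EnvGen y) (EnvGen x)) (EnvGen (lie x y))).

HB.instance Definition _ := gen_eqMixin env_term.
HB.instance Definition _ := gen_choiceMixin env_term.

Definition env_eqb (s t : env_term) : bool := `[< env_eq s t >].
Fact env_eqb_refl : reflexive env_eqb.
Proof. by move=> s; apply/asboolP; exact: env_refl. Qed.
Fact env_eqb_sym : symmetric env_eqb.
Proof.
by move=> s t; apply/asboolP/asboolP => h; exact: env_sym.
Qed.
Fact env_eqb_trans : transitive env_eqb.
Proof.
by move=> t s u /asboolP st /asboolP tu; apply/asboolP; exact: env_trans tu.
Qed.
Canonical env_equiv := EquivRel env_eqb env_eqb_refl env_eqb_sym env_eqb_trans.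

Definition env : Type := {eq_quot env_equiv}.
HB.instance Definition _ := Choice.on env.
HB.instance Definition _ := EqQuotient.on env.

Lemma env_pi s t : env_eq s t -> \pi_env s = \pi_env t.
Proof. by move=> st; apply/eqmodP/asboolP. Qed.
Lemma env_piP s t : \pi_env s = \pi_env t -> env_eq s t.
Proof. by move=> /eqmodP/asboolP. Qed.
Lemma env_reprK s : env_eq (repr (\pi_env s)) s.
Proof. by apply: env_piP; rewrite reprK. Qed.

Definition env_gen (x : L) : env := \pi_env (EnvGen x).
Definition env_const (a : F) : env := \pi_env (EnvConst a).
Definition env_addq (u v : env) : env := \pi_env (EnvAdd (repr u) (repr v)).
Definition env_mulq (u v : env) : env := \pi_env (EnvMul (repr u) (repr v)).
Definition env_oppq (u : env) : env := env_mulq (env_const (-1)) u.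

Lemma env_addqE s t : env_addq (\pi_env s) (\pi_env t) = \pi_env (EnvAdd s t).
Proof. by apply/env_pi/env_add; exact: env_reprK. Qed.
Lemma env_mulqE s t : env_mulq (\pi_env s) (\pi_env t) = \pi_env (EnvMul s t).
Proof. by apply/env_pi/env_mul; exact: env_reprK. Qed.

Fact env_addqA : associative env_addq.
Proof.
by elim/quotW => s; elim/quotW => t; elim/quotW => u;
  rewrite (env_addqE t u) (env_addqE s t) !env_addqE; apply/env_pi/env_addA.
Qed.
Fact env_addqC : commutative env_addq.
Proof.
by elim/quotW => s; elim/quotW => t; rewrite !env_addqE; apply/env_pi/env_addC.
Qed.
Fact env_addq0 : left_id (env_const 0) env_addq.
Proof. by elim/quotW => s; rewrite env_addqE; apply/env_pi/env_add0. Qed.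
Fact env_addqN : left_inverse (env_const 0) env_oppq env_addq.
Proof.
by elim/quotW => s; rewrite /env_oppq (env_mulqE (EnvConst (-1)) s) env_addqE;
  apply/env_pi/env_addN.
Qed.
HB.instance Definition _ := GRing.isZmodule.Build env
  env_addqA env_addqC env_addq0 env_addqN.

Fixpoint env_counit_term (s : env_term) : F :=
  match s with
  | EnvGen _ => 0
  | EnvConst a => a
  | EnvAdd s t => env_counit_term s + env_counit_term t
  | EnvMul s t => env_counit_term s * env_counit_term t
  end.

Lemma env_counit_eq s t : env_eq s t -> env_counit_term s = env_counit_term t.
Proof.
elim=> //=.
- by move=> s' s1 t' _ -> _ ->.
- by move=> s1 s' t1 t' _ -> _ ->.
- by move=> s1 s' t1 t' _ -> _ ->.
- by move=> *; rewrite addrA.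
- by move=> *; rewrite addrC.
- by move=> *; rewrite add0r.
- by move=> *; rewrite mulN1r addNr.
- by move=> *; rewrite mulrA.
- by move=> *; rewrite mul1r.
- by move=> *; rewrite mulrDl.
- by move=> *; rewrite mulrDr.
- by move=> *; rewrite mulrC.
- by move=> *; rewrite mulr0 addr0.
- by move=> *; rewrite mulr0 addr0.
Qed.

Fact env_mulqA : associative env_mulq.
Proof.
by elim/quotW => s; elim/quotW => t; elim/quotW => u;
  rewrite (env_mulqE t u) (env_mulqE s t) !env_mulqE; apply/env_pi/env_mulA.
Qed.
Fact env_mulq1l : left_id (env_const 1) env_mulq.
Proof. by elim/quotW => s; rewrite env_mulqE; apply/env_pi/env_mul1. Qed.
Fact env_mulq1r : right_id (env_const 1) env_mulq.
Proof.
elim/quotW => s; rewrite env_mulqE; apply/env_pi.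
by apply: env_trans (env_mul1 s); apply/env_sym/env_constC.
Qed.
Fact env_mulqDl : left_distributive env_mulq env_addq.
Proof.
by elim/quotW => s; elim/quotW => t; elim/quotW => u;
  rewrite (env_addqE s t) (env_mulqE s u) (env_mulqE t u) env_mulqE env_addqE;
  apply/env_pi/env_mulDl.
Qed.
Fact env_mulqDr : right_distributive env_mulq env_addq.
Proof.
by elim/quotW => u; elim/quotW => s; elim/quotW => t;
  rewrite (env_addqE s t) (env_mulqE u s) (env_mulqE u t) env_mulqE env_addqE;
  apply/env_pi/env_mulDr.
Qed.
Fact env_1_neq0 : env_const 1 != 0.
Proof.
apply/eqP => /env_piP/env_counit_eq /= /eqP.
by rewrite oner_eq0.
Qed.
HB.instance Definition _ := GRing.Zmodule_isNzRing.Build env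
  env_mulqA env_mulq1l env_mulq1r env_mulqDl env_mulqDr env_1_neq0.

Lemma env_piD s t : \pi_env (EnvAdd s t) = \pi_env s + \pi_env t.
Proof. by rewrite -env_addqE. Qed.
Lemma env_piM s t : \pi_env (EnvMul s t) = \pi_env s * \pi_env t.
Proof. by rewrite -env_mulqE. Qed.

Lemma env_constDE a b : env_const (a + b) = env_const a + env_const b.
Proof. by rewrite -env_piD; apply/env_pi/env_constD. Qed.
Lemma env_constME a b : env_const (a * b) = env_const a * env_const b.
Proof. by rewrite -env_piM; apply/env_pi/env_constM. Qed.
Lemma env_constCE a (u : env) : env_const a * u = u * env_const a.
Proof.
by elim/quotW: u => s; rewrite -!env_piM; apply/env_pi/env_constC.
Qed.

Definition env_scaleq (a : F) (u : env) : env := env_const a * u.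
Fact env_scaleqA a b u : env_scaleq a (env_scaleq b u) = env_scaleq (a * b) u.
Proof. by rewrite /env_scaleq mulrA env_constME. Qed.
Fact env_scaleq1 : left_id 1 env_scaleq.
Proof. by move=> u; rewrite /env_scaleq mul1r. Qed.
Fact env_scaleqDr : right_distributive env_scaleq +%R.
Proof. by move=> a u v; rewrite /env_scaleq mulrDr. Qed.
Fact env_scaleqDl u : {morph env_scaleq^~ u : a b / a + b}.
Proof. by move=> a b; rewrite /env_scaleq env_constDE mulrDl. Qed.
HB.instance Definition _ := GRing.Zmodule_isLmodule.Build F env
  env_scaleqA env_scaleq1 env_scaleqDr env_scaleqDl.
Fact env_scaleqAl a (u v : env) : a *: (u * v) = (a *: u) * v.
Proof. exact: mulrA. Qed.
HB.instance Definition _ := GRing.Lmodule_isLalgebra.Build F env env_scaleqAl.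
Fact env_scaleqAr a (u v : env) : a *: (u * v) = u * (a *: v).
Proof.
by rewrite -[LHS]/(env_const a * (u * v)) mulrA env_constCE -mulrA.
Qed.
HB.instance Definition _ := GRing.Lalgebra_isAlgebra.Build F env env_scaleqAr.

Lemma env_constE a : env_const a = a%:A.
Proof. by rewrite -[RHS]/(env_const a * 1) mulr1. Qed.

Fact env_gen_is_linear : linear env_gen.
Proof.
move=> a x y; rewrite -[a *: env_gen x]/(env_const a * env_gen x) -env_piM -env_piD.
exact/env_pi/env_gen_linear.
Qed.
HB.instance Definition _ := GRing.isLinear.Build F L env _ env_gen env_gen_is_linear.

Lemma env_gen_lieE x y :
  env_gen (lie x y) = env_gen x * env_gen y - env_gen y * env_gen x.
Proof.
apply/eqP; rewrite eq_sym subr_eq addrC; apply/eqP.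
rewrite -!env_piM -env_piD; exact/env_pi/env_gen_lie.
Qed.

(* A Lie module as a left U(L)-module; Section Restriction is the converse. *)
Section Module.
Variable M : lieModule L.

Fixpoint env_act_term (s : env_term) (v : M) : M :=
  match s with
  | EnvGen x => lact x v
  | EnvConst a => a *: v
  | EnvAdd s t => env_act_term s v + env_act_term t v
  | EnvMul s t => env_act_term s (env_act_term t v)
  end.

Fact env_act_term_linear s : linear (env_act_term s).
Proof.
elim: s => /= [x|b|s hs t ht|s hs t ht] a u v.
- exact: lact_linearr.
- by rewrite scalerDr !scalerA mulrC.
- by rewrite hs ht scalerDr addrACA.
- by rewrite ht hs.
Qed.
HB.instance Definition _ s :=
  GRing.isLinear.Build F M M _ (env_act_term s) (env_act_term_linear s).

Lemma env_act_eq s t : env_eq s t -> env_act_term s =1 env_act_term t.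
Proof.
elim=> //=.
- by move=> s1 t1 _ h v; rewrite h.
- by move=> t' s1 u _ h1 _ h2 v; rewrite h1.
- by move=> s1 s' t1 t' _ h1 _ h2 v; rewrite h1 h2.
- by move=> s1 s' t1 t' _ h1 _ h2 v; rewrite h1 h2.
- by move=> *; move=> v; rewrite addrA.
- by move=> *; move=> v; rewrite addrC.
- by move=> *; move=> v; rewrite scale0r add0r.
- by move=> *; move=> v; rewrite scaleN1r addNr scale0r.
- by move=> *; move=> v; rewrite scale1r.
- by move=> s1 t1 u v; rewrite linearD.
- by move=> a b v; rewrite scalerDl.
- by move=> a b v; rewrite scalerA.
- by move=> a s1 v; rewrite linearZ.
- by move=> a x y v; rewrite lact_linearl.
- by move=> x y v; rewrite lact_lie addrC subrK.
Qed.

Definition env_mod : Type := M.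
HB.instance Definition _ := GRing.Zmodule.on env_mod.
Definition env_act (u : env) (v : env_mod) : env_mod := env_act_term (repr u) v.

Lemma env_actE s (v : env_mod) : env_act (\pi_env s) v = env_act_term s v.
Proof. exact/env_act_eq/env_reprK. Qed.

Fact env_actA u w (v : env_mod) : env_act u (env_act w v) = env_act (u * w) v.
Proof.
by elim/quotW: u => s; elim/quotW: w => t; rewrite -env_piM !env_actE.
Qed.
Fact env_act1 : left_id 1 env_act.
Proof. by move=> v; rewrite env_actE /= scale1r. Qed.
Fact env_actDr : right_distributive env_act +%R.
Proof. by elim/quotW => s v w; rewrite !env_actE; exact: linearD. Qed.
Fact env_actDl v : {morph env_act^~ v : u w / u + w}.
Proof.
by elim/quotW => s; elim/quotW => t; rewrite -env_piD !env_actE.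
Qed.
HB.instance Definition _ := GRing.Zmodule_isLmodule.Build env env_mod
  env_actA env_act1 env_actDr env_actDl.
End Module.

Section Restriction.
Variable V : lmodType env.

Definition env_restr : Type := V.
HB.instance Definition _ := GRing.Zmodule.on env_restr.
Definition env_restr_scale (a : F) (v : env_restr) : env_restr :=
  (a%:A : env) *: (v : V).
Fact env_restr_scaleA a b v :
  env_restr_scale a (env_restr_scale b v) = env_restr_scale (a * b) v.
Proof. by rewrite /env_restr_scale scalerA -scalerAl mul1r scalerA. Qed.
Fact env_restr_scale1 : left_id 1 env_restr_scale.
Proof. by move=> v; rewrite /env_restr_scale !scale1r. Qed.
Fact env_restr_scaleDr : right_distributive env_restr_scale +%R.
Proof. by move=> a u v; rewrite /env_restr_scale scalerDr. Qed.
Fact env_restr_scaleDl v : {morph env_restr_scale^~ v : a b / a + b}.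
Proof. by move=> a b; rewrite /env_restr_scale !scalerDl. Qed.
HB.instance Definition _ := GRing.Zmodule_isLmodule.Build F env_restr
  env_restr_scaleA env_restr_scale1 env_restr_scaleDr env_restr_scaleDl.

Definition env_restr_act (x : L) (v : env_restr) : env_restr :=
  env_gen x *: (v : V).
Fact env_restr_act_linearl v : linear (env_restr_act^~ v).
Proof.
move=> a x y; rewrite /env_restr_act linearP scalerDl; congr (_ + _).
by rewrite -[RHS]/((a%:A : env) *: (env_gen x *: (v : V))) scalerA -scalerAl mul1r.
Qed.
Fact env_restr_act_linearr x : linear (env_restr_act x).
Proof.
move=> a u v; rewrite /env_restr_act scalerDr; congr (_ + _).
rewrite -[LHS]/(env_gen x *: ((a%:A : env) *: (u : V))).
rewrite -[RHS]/((a%:A : env) *: (env_gen x *: (u : V))).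
by rewrite !scalerA -scalerAl -scalerAr mul1r mulr1.
Qed.
Fact env_restr_act_lie x y v :
  env_restr_act (lie x y) v
  = env_restr_act x (env_restr_act y v) - env_restr_act y (env_restr_act x v).
Proof. by rewrite /env_restr_act env_gen_lieE scalerBl -!scalerA. Qed.
Definition env_restr_mod : lieModule L :=
  LieModule env_restr_act_linearl env_restr_act_linearr env_restr_act_lie.
End Restriction.

End EnvelopingAlgebra.

Section EnvMap.
Variables (F : numFieldType) (L L' : lieAlgType F) (f : lieHom L L').

Fixpoint env_map_term (s : env_term L) : env L' :=
  match s with
  | EnvGen x => env_gen (f x)
  | EnvConst a => a%:A
  | EnvAdd s t => env_map_term s + env_map_term t
  | EnvMul s t => env_map_term s * env_map_term t
  end.

Lemma env_map_eq s t : env_eq s t -> env_map_term s = env_map_term t.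
Proof.
elim=> //=.
- by move=> s' s1 t' _ -> _ ->.
- by move=> s1 s' t1 t' _ -> _ ->.
- by move=> s1 s' t1 t' _ -> _ ->.
- by move=> *; rewrite addrA.
- by move=> *; rewrite addrC.
- by move=> *; rewrite scale0r add0r.
- by move=> *; rewrite scaleN1r mulN1r addNr scale0r.
- by move=> *; rewrite mulrA.
- by move=> *; rewrite scale1r mul1r.
- by move=> *; rewrite mulrDl.
- by move=> *; rewrite mulrDr.
- by move=> *; rewrite scalerDl.
- by move=> *; rewrite -scalerAl mul1r scalerA.
- by move=> *; rewrite -scalerAl -scalerAr mul1r mulr1.
- by move=> *; rewrite !linearP -scalerAl mul1r.
- by move=> *; rewrite lhom_lie env_gen_lieE addrC subrK.
Qed.

Definition env_map (u : env L) : env L' := env_map_term (repr u).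

Lemma env_mapE s : env_map (\pi_(env L) s) = env_map_term s.
Proof. exact/env_map_eq/env_reprK. Qed.

Fact env_map_additive : zmod_morphism env_map.
Proof.
have D : {morph env_map : u v / u + v}.
  by elim/quotW => s; elim/quotW => t; rewrite -env_piD !env_mapE.
move=> u v; apply: (addIr (env_map v)).
by rewrite -D !subrK.
Qed.
HB.instance Definition _ := GRing.isZmodMorphism.Build _ _ env_map env_map_additive.
Fact env_map_multiplicative : monoid_morphism env_map.
Proof.
split; first by rewrite env_mapE /= scale1r.
by elim/quotW => s; elim/quotW => t; rewrite -env_piM !env_mapE.
Qed.
HB.instance Definition _ :=
  GRing.isMonoidMorphism.Build _ _ env_map env_map_multiplicative.
End EnvMap.

Section ExtensionOfScalars.
Variables (R S : nzRingType) (phi : {rmorphism R -> S}) (N : lmodType R).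

(* S (x)_R N, with S a right R-module through phi: formal sums of pure tensors
   modulo biadditivity and (a phi(r)) (x) n = a (x) (r n). *)
Inductive tens_term : Type :=
  | TensPure of S & N
  | TensZero
  | TensOpp of tens_term
  | TensAdd of tens_term & tens_term.

Inductive tens_eq : tens_term -> tens_term -> Prop :=
  | tens_refl s : tens_eq s s
  | tens_sym s t : tens_eq s t -> tens_eq t s
  | tens_trans t s u : tens_eq s t -> tens_eq t u -> tens_eq s u
  | tens_opp s s' : tens_eq s s' -> tens_eq (TensOpp s) (TensOpp s')
  | tens_add s s' t t' :
      tens_eq s s' -> tens_eq t t' -> tens_eq (TensAdd s t) (TensAdd s' t')
  | tens_addA s t u :
      tens_eq (TensAdd s (TensAdd t u)) (TensAdd (TensAdd s t) u)
  | tens_addC s t : tens_eq (TensAdd s t) (TensAdd t s)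
  | tens_add0 s : tens_eq (TensAdd TensZero s) s
  | tens_addN s : tens_eq (TensAdd (TensOpp s) s) TensZero
  | tens_pureDl a b n :
      tens_eq (TensPure (a + b) n) (TensAdd (TensPure a n) (TensPure b n))
  | tens_pureDr a m n :
      tens_eq (TensPure a (m + n)) (TensAdd (TensPure a m) (TensPure a n))
  | tens_balanced a r n : tens_eq (TensPure (a * phi r) n) (TensPure a (r *: n)).

HB.instance Definition _ := gen_eqMixin tens_term.
HB.instance Definition _ := gen_choiceMixin tens_term.

Definition tens_eqb (s t : tens_term) : bool := `[< tens_eq s t >].
Fact tens_eqb_refl : reflexive tens_eqb.
Proof. by move=> s; apply/asboolP; exact: tens_refl. Qed.
Fact tens_eqb_sym : symmetric tens_eqb.
Proof. by move=> s t; apply/asboolP/asboolP => h; exact: tens_sym. Qed.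
Fact tens_eqb_trans : transitive tens_eqb.
Proof.
by move=> t s u /asboolP st /asboolP tu; apply/asboolP; exact: tens_trans tu.
Qed.
Canonical tens_equiv := EquivRel tens_eqb tens_eqb_refl tens_eqb_sym tens_eqb_trans.

Definition tens : Type := {eq_quot tens_equiv}.
HB.instance Definition _ := Choice.on tens.
HB.instance Definition _ := EqQuotient.on tens.

Lemma tens_pi s t : tens_eq s t -> \pi_tens s = \pi_tens t.
Proof. by move=> st; apply/eqmodP/asboolP. Qed.
Lemma tens_piP s t : \pi_tens s = \pi_tens t -> tens_eq s t.
Proof. by move=> /eqmodP/asboolP. Qed.
Lemma tens_reprK s : tens_eq (repr (\pi_tens s)) s.
Proof. by apply: tens_piP; rewrite reprK. Qed.

Definition pure (a : S) (n : N) : tens := \pi_tens (TensPure a n).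
Definition tens_zeroq : tens := \pi_tens TensZero.
Definition tens_oppq (u : tens) : tens := \pi_tens (TensOpp (repr u)).
Definition tens_addq (u v : tens) : tens := \pi_tens (TensAdd (repr u) (repr v)).

Lemma tens_oppqE s : tens_oppq (\pi_tens s) = \pi_tens (TensOpp s).
Proof. exact/tens_pi/tens_opp/tens_reprK. Qed.
Lemma tens_addqE s t : tens_addq (\pi_tens s) (\pi_tens t) = \pi_tens (TensAdd s t).
Proof. by apply/tens_pi/tens_add; exact: tens_reprK. Qed.

Fact tens_addqA : associative tens_addq.
Proof.
by elim/quotW => s; elim/quotW => t; elim/quotW => u;
  rewrite (tens_addqE t u) (tens_addqE s t) !tens_addqE; apply/tens_pi/tens_addA.
Qed.
Fact tens_addqC : commutative tens_addq.
Proof.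
by elim/quotW => s; elim/quotW => t; rewrite !tens_addqE; apply/tens_pi/tens_addC.
Qed.
Fact tens_addq0 : left_id tens_zeroq tens_addq.
Proof. by elim/quotW => s; rewrite tens_addqE; apply/tens_pi/tens_add0. Qed.
Fact tens_addqN : left_inverse tens_zeroq tens_oppq tens_addq.
Proof.
by elim/quotW => s; rewrite (tens_oppqE s) tens_addqE; apply/tens_pi/tens_addN.
Qed.
HB.instance Definition _ := GRing.isZmodule.Build tens
  tens_addqA tens_addqC tens_addq0 tens_addqN.

Lemma tens_piD s t : \pi_tens (TensAdd s t) = \pi_tens s + \pi_tens t.
Proof. by rewrite -tens_addqE. Qed.
Lemma tens_piN s : \pi_tens (TensOpp s) = - \pi_tens s.
Proof. by rewrite -tens_oppqE. Qed.

Lemma pureDl a b n : pure (a + b) n = pure a n + pure b n.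
Proof. by rewrite -tens_piD; apply/tens_pi/tens_pureDl. Qed.
Lemma pureDr a m n : pure a (m + n) = pure a m + pure a n.
Proof. by rewrite -tens_piD; apply/tens_pi/tens_pureDr. Qed.
Lemma pure_balanced a r n : pure (a * phi r) n = pure a (r *: n).
Proof. by apply/tens_pi/tens_balanced. Qed.

Fixpoint tens_scale_term (c : S) (s : tens_term) : tens :=
  match s with
  | TensPure a n => pure (c * a) n
  | TensZero => 0
  | TensOpp s => - tens_scale_term c s
  | TensAdd s t => tens_scale_term c s + tens_scale_term c t
  end.

Lemma tens_scale_eq c s t :
  tens_eq s t -> tens_scale_term c s = tens_scale_term c t.
Proof.
elim=> //=.
- by move=> s' s1 t' _ -> _ ->.
- by move=> s1 s' _ ->.
- by move=> s1 s' t1 t' _ -> _ ->.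
- by move=> *; rewrite addrA.
- by move=> *; rewrite addrC.
- by move=> *; rewrite add0r.
- by move=> *; rewrite addNr.
- by move=> *; rewrite mulrDr pureDl.
- by move=> *; rewrite pureDr.
- by move=> *; rewrite mulrA pure_balanced.
Qed.

Definition tens_scale (c : S) (u : tens) : tens := tens_scale_term c (repr u).

Lemma tens_scaleE c s : tens_scale c (\pi_tens s) = tens_scale_term c s.
Proof. exact/tens_scale_eq/tens_reprK. Qed.

Lemma tens_ind (P : tens -> Prop) :
  (forall a n, P (pure a n)) -> P 0 -> (forall u, P u -> P (- u)) ->
  (forall u v, P u -> P v -> P (u + v)) -> forall u, P u.
Proof.
move=> Pp P0 PN PD; elim/quotW; elim=> [a n||s hs|s hs t ht].
- exact: Pp.
- exact: P0.
- by rewrite tens_piN; exact: PN.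
- by rewrite tens_piD; exact: PD.
Qed.

Lemma tens_scale_pure c a n : tens_scale c (pure a n) = pure (c * a) n.
Proof. by rewrite tens_scaleE. Qed.
Lemma tens_scale0 c : tens_scale c 0 = 0.
Proof. by rewrite tens_scaleE. Qed.
Lemma tens_scaleN c u : tens_scale c (- u) = - tens_scale c u.
Proof. by elim/quotW: u => s; rewrite -tens_piN !tens_scaleE. Qed.
Fact tens_scaleDr : right_distributive tens_scale +%R.
Proof.
by move=> c; elim/quotW => s; elim/quotW => t; rewrite -tens_piD !tens_scaleE.
Qed.
Fact tens_scaleA c e u : tens_scale c (tens_scale e u) = tens_scale (c * e) u.
Proof.
elim/tens_ind: u => [a n||u hu|u v hu hv].
- by rewrite !tens_scale_pure mulrA.
- by rewrite !tens_scale0.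
- by rewrite !tens_scaleN hu.
- by rewrite !tens_scaleDr hu hv.
Qed.
Fact tens_scale1 : left_id 1 tens_scale.
Proof.
elim/tens_ind => [a n||u hu|u v hu hv].
- by rewrite tens_scale_pure mul1r.
- by rewrite tens_scale0.
- by rewrite tens_scaleN hu.
- by rewrite tens_scaleDr hu hv.
Qed.
Fact tens_scaleDl u : {morph tens_scale^~ u : c e / c + e}.
Proof.
move=> c e; elim/tens_ind: u => [a n||u hu|u v hu hv].
- by rewrite !tens_scale_pure mulrDl pureDl.
- by rewrite !tens_scale0 addr0.
- by rewrite !tens_scaleN hu opprD.
- by rewrite !tens_scaleDr hu hv addrACA.
Qed.
HB.instance Definition _ := GRing.Zmodule_isLmodule.Build S tens
  tens_scaleA tens_scale1 tens_scaleDr tens_scaleDl.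

Lemma scale_pure c a n : c *: pure a n = pure (c * a) n.
Proof. exact: tens_scale_pure. Qed.
End ExtensionOfScalars.

Section Induction.
Variables (F : numFieldType) (P L : lieAlgType F) (f : lieHom P L).
Variable W : lieModule P.

(* U(L) (x)_U(P) W *)
Definition ind_mod : lieModule L :=
  env_restr_mod (tens (env_map f) (env_mod W)).
Definition ind_top (w : W) : ind_mod :=
  pure (env_map f) (1 : env L) (w : env_mod W).

Lemma lact_ind_top x w : lact (f x) (ind_top w) = ind_top (lact x w).
Proof.
rewrite -[LHS]/(env_gen (f x) *: pure (env_map f) (1 : env L) (w : env_mod W)).
rewrite scale_pure mulr1.
have -> : env_gen (f x) = 1 * env_map f (env_gen x) by rewrite env_mapE mul1r.
by rewrite pure_balanced /ind_top; congr (pure _ _ _); exact: env_actE.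
Qed.
End Induction.

Section Submodules.
Variables (F : numFieldType) (L : lieAlgType F) (M : lieModule L).
Local Open Scope classical_set_scope.

Record submodule := Submodule {
  submod_set :> M -> Prop;
  submod_set0 : submod_set 0;
  submod_linear : forall a u v, submod_set u -> submod_set v -> submod_set (a *: u + v);
  submod_lact : forall x v, submod_set v -> submod_set (lact x v)
}.

Definition irreducible : Prop :=
  (exists v : M, v != 0) /\
  forall N : submodule, submod_set N = [set 0] \/ submod_set N = setT.

Variable N : submodule.

Lemma submodD u v : N u -> N v -> N (u + v).
Proof. by move=> Nu Nv; rewrite -[u]scale1r; exact: submod_linear. Qed.
Lemma submodZ a u : N u -> N (a *: u).
Proof. by move=> Nu; rewrite -[_ *: u]addr0; exact/submod_linear/submod_set0. Qed.
Lemma submodN u : N u -> N (- u).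
Proof. by move=> Nu; rewrite -scaleN1r; exact: submodZ. Qed.

Definition submod_rel (u v : M) : bool := `[< N (u - v) >].
Fact submod_rel_refl : reflexive submod_rel.
Proof. by move=> u; apply/asboolP; rewrite subrr; exact: submod_set0. Qed.
Fact submod_rel_sym : symmetric submod_rel.
Proof.
by move=> u v; apply/asboolP/asboolP => /submodN; rewrite opprB.
Qed.
Fact submod_rel_trans : transitive submod_rel.
Proof.
move=> v u w /asboolP uv /asboolP vw; apply/asboolP.
by rewrite -(subrK v u) -addrA; exact: submodD.
Qed.
Canonical submod_equiv := EquivRel submod_rel submod_rel_refl submod_rel_sym submod_rel_trans.

Definition quot : Type := {eq_quot submod_equiv}.
HB.instance Definition _ := Choice.on quot.
HB.instance Definition _ := EqQuotient.on quot.

Lemma quot_pi u v : N (u - v) -> \pi_quot u = \pi_quot v.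
Proof. by move=> uv; apply/eqmodP/asboolP. Qed.
Lemma quot_piP u v : \pi_quot u = \pi_quot v -> N (u - v).
Proof. by move=> /eqmodP/asboolP. Qed.
Lemma quot_reprK u : N (repr (\pi_quot u) - u).
Proof. by apply: quot_piP; rewrite reprK. Qed.

Definition quot_add (u v : quot) : quot := \pi_quot (repr u + repr v).
Definition quot_opp (u : quot) : quot := \pi_quot (- repr u).
Definition quot_scale (a : F) (u : quot) : quot := \pi_quot (a *: repr u).
Definition quot_act (x : L) (u : quot) : quot := \pi_quot (lact x (repr u)).

Lemma quot_addE u v : quot_add (\pi_quot u) (\pi_quot v) = \pi_quot (u + v).
Proof.
by apply: quot_pi; rewrite opprD addrACA; apply: submodD; exact: quot_reprK.
Qed.
Lemma quot_oppE u : quot_opp (\pi_quot u) = \pi_quot (- u).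
Proof. by apply: quot_pi; rewrite -opprD; apply: submodN; exact: quot_reprK. Qed.
Lemma quot_scaleE a u : quot_scale a (\pi_quot u) = \pi_quot (a *: u).
Proof. by apply: quot_pi; rewrite -scalerBr; apply: submodZ; exact: quot_reprK. Qed.
Lemma quot_actE x u : quot_act x (\pi_quot u) = \pi_quot (lact x u).
Proof.
by apply: quot_pi; rewrite -(linearB (lact x)); apply: submod_lact; exact: quot_reprK.
Qed.

Fact quot_addA : associative quot_add.
Proof.
by elim/quotW => u; elim/quotW => v; elim/quotW => w;
  rewrite (quot_addE v w) (quot_addE u v) !quot_addE addrA.
Qed.
Fact quot_addC : commutative quot_add.
Proof. by move=> u v; rewrite /quot_add addrC. Qed.
Fact quot_add0 : left_id (\pi_quot 0) quot_add.
Proof. by elim/quotW => u; rewrite quot_addE add0r. Qed.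
Fact quot_addN : left_inverse (\pi_quot 0) quot_opp quot_add.
Proof. by elim/quotW => u; rewrite (quot_oppE u) quot_addE addNr. Qed.
HB.instance Definition _ := GRing.isZmodule.Build quot
  quot_addA quot_addC quot_add0 quot_addN.

Lemma quot_piD u v : \pi_quot (u + v) = \pi_quot u + \pi_quot v.
Proof. by rewrite -quot_addE. Qed.

Fact quot_scaleA a b u : quot_scale a (quot_scale b u) = quot_scale (a * b) u.
Proof.
by elim/quotW: u => u; rewrite (quot_scaleE b u) !quot_scaleE scalerA.
Qed.
Fact quot_scale1 : left_id 1 quot_scale.
Proof. by elim/quotW => u; rewrite quot_scaleE scale1r. Qed.
Fact quot_scaleDr : right_distributive quot_scale +%R.
Proof.
move=> a; elim/quotW => u; elim/quotW => v.
by rewrite -quot_piD !quot_scaleE -quot_piD scalerDr.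
Qed.
Fact quot_scaleDl u : {morph quot_scale^~ u : a b / a + b}.
Proof.
by elim/quotW: u => u a b; rewrite !quot_scaleE -quot_piD scalerDl.
Qed.
HB.instance Definition _ := GRing.Zmodule_isLmodule.Build F quot
  quot_scaleA quot_scale1 quot_scaleDr quot_scaleDl.

Lemma quot_piZ a u : \pi_quot (a *: u) = a *: \pi_quot u.
Proof. by rewrite -quot_scaleE. Qed.
Lemma quot_piN u : \pi_quot (- u) = - \pi_quot u.
Proof. by rewrite -!scaleN1r quot_piZ. Qed.

Fact quot_act_linearl u : linear (quot_act^~ u).
Proof.
elim/quotW: u => u a x y.
by rewrite !quot_actE -quot_piZ -quot_piD lact_linearl.
Qed.
Fact quot_act_linearr x : linear (quot_act x).
Proof.
move=> a; elim/quotW => u; elim/quotW => v.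
by rewrite -quot_piZ -quot_piD !quot_actE -quot_piZ -quot_piD lact_linearr.
Qed.
Fact quot_act_lie x y u :
  quot_act (lie x y) u = quot_act x (quot_act y u) - quot_act y (quot_act x u).
Proof.
elim/quotW: u => u.
rewrite (quot_actE y u) (quot_actE x u) !quot_actE.
by rewrite -quot_piN -quot_piD lact_lie.
Qed.
Definition quot_mod : lieModule L :=
  LieModule quot_act_linearl quot_act_linearr quot_act_lie.
End Submodules.

Section NappiWitten.
Variable F : numFieldType.

Definition H4 : Type := 'rV[F]_4.
HB.instance Definition _ := GRing.Lmodule.on H4.

Definition ja : 'I_4 := Ordinal (isT : (0 < 4)%N).
Definition jb : 'I_4 := Ordinal (isT : (1 < 4)%N).
Definition jc : 'I_4 := Ordinal (isT : (2 < 4)%N).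
Definition jd : 'I_4 := Ordinal (isT : (3 < 4)%N).

Definition H4a : H4 := delta_mx 0 ja.
Definition H4b : H4 := delta_mx 0 jb.
Definition H4c : H4 := delta_mx 0 jc.
Definition H4d : H4 := delta_mx 0 jd.

Implicit Types x y z : 'rV[F]_4.

Definition H4_lie x y : H4 :=
    (x 0 jd * y 0 ja - x 0 ja * y 0 jd) *: H4a
  - (x 0 jd * y 0 jb - x 0 jb * y 0 jd) *: H4b
  + (x 0 ja * y 0 jb - x 0 jb * y 0 ja) *: H4c.

Definition H4_form x y : F :=
  x 0 ja * y 0 jb + x 0 jb * y 0 ja + x 0 jc * y 0 jd + x 0 jd * y 0 jc.

Lemma H4_lieE x y (j : 'I_4) : H4_lie x y 0 j =
    (x 0 jd * y 0 ja - x 0 ja * y 0 jd) * (j == ja)%:R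
  - (x 0 jd * y 0 jb - x 0 jb * y 0 jd) * (j == jb)%:R
  + (x 0 ja * y 0 jb - x 0 jb * y 0 ja) * (j == jc)%:R.
Proof. by rewrite !mxE. Qed.

Fact H4_lie_linearl y : linear (H4_lie^~ y : H4 -> H4).
Proof. by move=> k x z; apply/rowP => j; rewrite !mxE; ring. Qed.
Fact H4_lie_linearr x : linear (H4_lie x : H4 -> H4).
Proof. by move=> k y z; apply/rowP => j; rewrite !mxE; ring. Qed.
Fact H4_lie_alt x : H4_lie x x = 0.
Proof. by apply/rowP => j; rewrite !mxE; ring. Qed.
Fact H4_lie_jacobi x y z :
  H4_lie x (H4_lie y z) + H4_lie y (H4_lie z x) + H4_lie z (H4_lie x y) = 0.
Proof. by apply/rowP => j; rewrite !mxE /=; ring. Qed.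
HB.instance Definition _ := Lmodule_isLieAlgebra.Build F H4
  H4_lie_linearl H4_lie_linearr H4_lie_alt H4_lie_jacobi.

Fact H4_form_linear y : linear (H4_form^~ y : H4 -> F^o).
Proof.
by move=> k x z; rewrite /H4_form !mxE /GRing.scale /=; ring.
Qed.
Fact H4_formC x y : H4_form x y = H4_form y x.
Proof. by rewrite /H4_form; ring. Qed.
Fact H4_form_inv x y z : H4_form (H4_lie x y) z = H4_form x (H4_lie y z).
Proof. by rewrite /H4_form !mxE /=; ring. Qed.
HB.instance Definition _ := LieAlgebra_isQuadratic.Build F H4
  H4_form_linear H4_formC H4_form_inv.

Lemma H4_brackets :
  [/\ lie H4a H4b = H4c, lie H4d H4a = H4a & lie H4d H4b = - H4b]
  /\ [/\ lie H4c H4d = 0, lie H4c H4a = 0 & lie H4c H4b = 0].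
Proof.
by split; split; apply/rowP => j; rewrite !mxE /=; ring.
Qed.

Lemma H4_forms :
  [/\ iform H4a H4b = 1, iform H4c H4d = 1, iform H4a H4a = 0,
      iform H4b H4b = 0 & iform H4c H4c = 0]
  /\ [/\ iform H4d H4d = 0, iform H4a H4c = 0, iform H4a H4d = 0,
      iform H4b H4c = 0 & iform H4b H4d = 0].
Proof.
by split; split; rewrite /iform /= /H4_form !mxE /=; ring.
Qed.

Variables (l dd : F).

Definition H4_char_act (x : H4) (v : F^o) : F^o := dd * x 0 jd * v.
Fact H4_char_linearl v : linear (H4_char_act^~ v).
Proof. by move=> k x y; rewrite /H4_char_act !mxE /GRing.scale /=; ring. Qed.
Fact H4_char_linearr (x : H4) : linear (H4_char_act x).
Proof. by move=> k u v; rewrite /H4_char_act /GRing.scale /=; ring. Qed.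
Fact H4_char_lie (x y : H4) v : H4_char_act (lie x y) v
  = H4_char_act x (H4_char_act y v) - H4_char_act y (H4_char_act x v).
Proof. by rewrite /H4_char_act !mxE /=; ring. Qed.
Definition H4_char : lieModule H4 :=
  LieModule H4_char_linearl H4_char_linearr H4_char_lie.

Definition hatH4_char_act (u : affine H4) (v : F^o) : F^o :=
  H4_char_act u.1@_0 v.
Fact hatH4_char_linearl v : linear (hatH4_char_act^~ v).
Proof.
move=> k x y; rewrite /hatH4_char_act /= mcoeffD laurent_coefZ.
exact: H4_char_linearl.
Qed.
Fact hatH4_char_linearr (x : affine H4) : linear (hatH4_char_act x).
Proof. exact: H4_char_linearr. Qed.
Fact hatH4_char_lie (x y : affine H4) v : hatH4_char_act (lie x y) v
  = hatH4_char_act x (hatH4_char_act y v) - hatH4_char_act y (hatH4_char_act x v).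
Proof.
rewrite /hatH4_char_act.
have act0 (z : H4) : z 0 jd = 0 -> H4_char_act z v = 0.
  by move=> z0; rewrite /H4_char_act z0 mulr0 mul0r.
rewrite act0; last first.
  rewrite /= raddf_sum summxE big1 // => m _.
  rewrite raddf_sum summxE big1 // => n _.
  by rewrite /= mcoeffU; case: eqP => _; rewrite ?mulr0n ?mulr1n !mxE //=; ring.
by rewrite /H4_char_act; ring.
Qed.
Definition hatH4_char : lieModule (affine H4) :=
  LieModule hatH4_char_linearl hatH4_char_linearr hatH4_char_lie.

(* V(l, d), with d the scalar dd *)
Definition VhatH4 : lieModule (affine H4) :=
  ind_mod (ge0_incl H4) (ge0_mod H4_char l).
End NappiWitten.

Section Grading.
Variables (F : numFieldType) (g : quadLieAlgType F) (W : lieModule (affine_ge0 g)).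
Local Notation V := (ind_mod (ge0_incl g) W).

(* The grading of U(g^) (x)_U(g^>=0) W in which W has degree 0 and x (x) t^m has
   degree -m: homog n is the component of degree n. *)
Inductive homog : int -> V -> Prop :=
  | homog_top w : homog 0 (ind_top (ge0_incl g) w)
  | homog_0 n : homog n 0
  | homog_lin n a u v : homog n u -> homog n v -> homog n (a *: u + v)
  | homog_loop n x m v : homog n v -> homog (n - m) (lact (loop x m) v)
  | homog_central n v : homog n v -> homog n (lact (central g) v).

(* The irreducible quotient of the induced module is the quotient by its largest
   proper graded submodule. The grading cannot be dropped: at level 0 the element
   c (x) t^-1 is central, and for every scalar s the module generated by
   (c (x) t^-1 - s) v is a proper submodule, so there are proper submodules whose
   sum is everything. *)
Definition graded_submod (N : submodule V) : Prop :=
  forall v, N v -> exists (r : seq int) (w : int -> V),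
    (forall n, homog n (w n) /\ N (w n)) /\ v = \sum_(n <- r) w n.

Definition proper_submod (N : submodule V) : Prop := exists v, ~ N v.

Definition largest_graded (J : submodule V) : Prop :=
  [/\ graded_submod J, proper_submod J &
      forall N : submodule V, graded_submod N -> proper_submod N ->
        forall v, N v -> J v].
End Grading.

(* Main.v *)
(* At level 0 the operators d (x) t^n commute up to terms without d-component, so they
   act on lines by arbitrary scalars: this makes d (x) t^-1 v nonzero, while the
   quotient onto C v kills it. The kernel of that quotient is the largest proper graded
   submodule because the degree 0 part of the induced module is the top.

   At level l <> 0, c (x) t^0 acts as 0 and a Sugawara-type operator T built from normally
   ordered products of a, b and c, d satisfies [T, x (x) t^n] = - n l x (x) t^n, hence acts
   on degree n as n l. Any nonzero submodule contains a nonzero vector killed by all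
   positive modes and, b (x) t^0 being locally nilpotent, one also killed by b (x) t^0;
   T vanishes on it, so it has degree 0 and generates everything. The top vector is
   nonzero because it maps to the vacuum of a free field (Wakimoto-type) realization. *)

From HB Require Import structures.
Require Import Defs.
From mathcomp Require Import all_boot all_order all_algebra finmap.
From mathcomp.multinomials Require Import monalg.
From mathcomp Require Import boolp classical_sets functions fsbigop.
From mathcomp Require Import reals complex zify ring.

Set Implicit Arguments.
Unset Strict Implicit.
Unset Printing Implicit Defensive.

Import Order.TTheory GRing.Theory Num.Theory.
Local Open Scope ring_scope.

(** The induced module is presented by terms and relations, so spanning and vanishing follow by
    induction on generation, whereas nonvanishing does not. Every nonvanishing statement is
    therefore obtained from a homomorphism into a concrete module: a character at level 0, a Fock
    space at level [l != 0]. Likewise, homogeneous decompositions are only shown to exist;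
    independence of the components comes from the eigenvalues [n l] of T, which are distinct because
    [l != 0].

    T also contains a term quadratic in c. It is forced: since [a, b] = c, reordering a and b leaves
    a multiple of c (x) t^n in [T, d (x) t^n]. Up to the factor [l], T is the Sugawara operator of
    the form l ( , ) + K / 2, where K is the Killing form, whose only nonzero value on basis vectors
    is K(d, d) = 2; inverting this form gives the coefficient -1 / (2 l) of c c. The vector has to
    be killed by b (x) t^0 because the zero mode part of the a b sum is a_0 b_0; that of the c d sum
    vanishes with c_0. *)

(** * Finitely supported sums over the integers *)

Section FiniteSums.
Implicit Types (V : zmodType) (N : nat).

(** The value is 0 when the support is infinite. Hence congruence and reindexing hold
    unconditionally, while additivity and exchange with additive maps carry [fin_supp]
    conditions. *)
Definition isum V (f : int -> V) : V := (\sum_(j \in [set: int]%classic) f j)%R.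
Definition fin_supp V (f : int -> V) :=
  exists N, forall j : int, (N < `|j|)%N -> f j = 0.

Lemma isumE V N (f : int -> V) : (forall j : int, (N < `|j|)%N -> f j = 0) ->
  isum f = \sum_(i < N.*2.+1) f (i%:Z - N%:Z).
Proof.
move=> f0; rewrite /isum.
set s := [seq i%:Z - N%:Z | i <- iota 0 N.*2.+1].
have us : uniq s by rewrite map_inj_uniq ?iota_uniq // => i j; lia.
rewrite (fsbigE s) // => [|/= i _ si]; last first.
  apply: (f0 i); rewrite ltnNge; apply: contra si => iN; apply/mapP.
  by exists (absz ((i : int) + N%:Z)); [rewrite mem_iota|]; lia.
rewrite -(big_mkord xpredT (fun i => f (i%:Z - N%:Z))).
by rewrite /index_iota subn0 /s big_map; apply: eq_bigl => i; rewrite in_setT.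
Qed.

Lemma eq_isum V (f g : int -> V) : f =1 g -> isum f = isum g.
Proof. by move=> fg; apply: eq_fsbigr => j _; exact: fg. Qed.

Lemma isum0 V (f : int -> V) : (forall j, f j = 0) -> isum f = 0.
Proof. by move=> f0; rewrite /isum fsbig1. Qed.

Lemma isum_shift V (f : int -> V) m : isum (fun j => f (j + m)) = isum f.
Proof.
rewrite /isum (reindex_fsbigT (fun j : int => j + m) f) //.
by exists (fun j => j - m) => j; rewrite ?addrK ?subrK.
Qed.

Lemma isum_reflect V (f : int -> V) m : isum (fun j => f (m - j)) = isum f.
Proof.
rewrite /isum (reindex_fsbigT (fun j : int => m - j) f) //.
by exists (fun j => m - j) => j; rewrite subKr.
Qed.

Lemma isum_single V (f : int -> V) m :
  (forall j, j != m -> f j = 0) -> isum f = f m.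
Proof.
move=> f0; rewrite -(isum_shift f m) (@isumE _ 0) ?big_ord1 ?add0r //.
by move=> j j0; apply: f0; lia.
Qed.

Lemma fin_suppD V (f g : int -> V) :
  fin_supp f -> fin_supp g -> fin_supp (fun j => f j + g j).
Proof.
move=> [N fN] [N' gN]; exists (maxn N N') => j jN.
by rewrite fN ?gN ?addr0 //; lia.
Qed.

Lemma fin_supp_map V V' (h : V -> V') (f : int -> V) : h 0 = 0 ->
  fin_supp f -> fin_supp (fun j => h (f j)).
Proof. by move=> h0 [N fN]; exists N => j jN; rewrite fN. Qed.

Lemma fin_supp_eq V (f h : int -> V) : f =1 h -> fin_supp f -> fin_supp h.
Proof. by move=> /funext ->. Qed.

Lemma fin_supp_shift V (f : int -> V) m :
  fin_supp f -> fin_supp (fun j => f (j + m)).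
Proof. by move=> [N fN]; exists (N + `|m|)%N => j jN; apply: fN; lia. Qed.

Lemma fin_supp_single V (f : int -> V) m :
  (forall j, j != m -> f j = 0) -> fin_supp f.
Proof. by move=> f0; exists `|m|%N => j jm; apply: f0; lia. Qed.

Lemma isum_add V (f g : int -> V) : fin_supp f -> fin_supp g ->
  isum (fun j => f j + g j) = isum f + isum g.
Proof.
move=> [N fN] [N' gN]; rewrite !(@isumE _ (maxn N N')) ?big_split //.
- by move=> j jN; apply: gN; lia.
- by move=> j jN; apply: fN; lia.
- by move=> j jN; rewrite fN ?gN ?addr0 //; lia.
Qed.

Lemma isum_map V V' (h : {additive V -> V'}) (f : int -> V) : fin_supp f ->
  isum (fun j => h (f j)) = h (isum f).
Proof.
move=> [N fN]; rewrite !(@isumE _ N) ?raddf_sum //.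
by move=> j jN; rewrite fN ?raddf0.
Qed.

Lemma isum_opp V (f : int -> V) : fin_supp f -> isum (fun j => - f j) = - isum f.
Proof. exact: (isum_map (f := f) [the {additive V -> V} of -%R]). Qed.

Lemma fin_supp_opp V (f : int -> V) : fin_supp f -> fin_supp (fun j => - f j).
Proof. exact: fin_supp_map (oppr0 V). Qed.

Lemma isum_sub V (f g : int -> V) : fin_supp f -> fin_supp g ->
  isum (fun j => f j - g j) = isum f - isum g.
Proof.
by move=> ff fg; rewrite isum_add ?isum_opp //; exact: fin_supp_opp.
Qed.

(* The constant by which a normally ordered sum changes when its ordering point
   is moved from 0 to m. *)
Lemma isum_step (R : nzRingType) (m : int) :
  let f (j : int) : R := (m <= j)%R%:R - (0 <= j)%R%:R in
  fin_supp f /\ isum f = - m%:~R.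
Proof.
move=> f; split.
  exists `|m|%N => j jm; rewrite /f.
  have -> : (m <= j)%R = (0 <= j)%R by lia.
  by rewrite subrr.
rewrite {}/f; elim/int_rect: m => [|n IH|n IH].
- by rewrite isum0 ?oppr0 // => j; rewrite subrr.
(* Passing from the threshold n to n + 1 loses exactly the index n; in the negative case below,
   passing from -n to -(n + 1) gains exactly -(n + 1). *)
- rewrite (@eq_isum _ _ (fun j : int =>
    ((n%:Z <= j)%R%:R - (0 <= j)%R%:R) - (j == n)%:R)); last first.
    move=> j; rewrite addrAC; congr (_ - _).
    have [->|jn] := eqVneq j n%:Z; first by rewrite lexx (_ : (_ <= _)%R = false) ?subrr //; lia.
    by rewrite subr0; congr (nat_of_bool _)%:R; lia.
  rewrite isum_sub; first last.
  + by apply: (@fin_supp_single _ _ n) => j /negPf ->.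
  + exists n => j jm; have -> : (n%:Z <= j)%R = (0 <= j)%R by lia.
    by rewrite subrr.
  rewrite IH (@isum_single _ _ n) ?eqxx => [|j /negPf -> //].
  by rewrite -opprD -addn1 PoszD rmorphD.
- rewrite (@eq_isum _ _ (fun j : int =>
    ((- n%:Z <= j)%R%:R - (0 <= j)%R%:R) + (j == - n.+1%:Z)%:R)); last first.
    move=> j; rewrite addrAC; congr (_ - _).
    have [->|jn] := eqVneq j (- n.+1%:Z).
      by rewrite lexx (_ : (_ <= _)%R = false) ?add0r //; lia.
    by rewrite addr0; congr (nat_of_bool _)%:R; lia.
  rewrite isum_add; first last.
  + by apply: (@fin_supp_single _ _ (- n.+1%:Z)) => j /negPf ->.
  + exists n => j jm; have -> : (- n%:Z <= j)%R = (0 <= j)%R by lia.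
    by rewrite subrr.
  rewrite IH (@isum_single _ _ (- n.+1%:Z)) ?eqxx => [|j /negPf -> //].
  by rewrite -addn1 PoszD opprD !rmorphD /= !rmorphN !opprD !opprK.
Qed.
End FiniteSums.

(** * Universal properties of extension of scalars and of induction *)

Section TensorLift.
Variables (R S : nzRingType) (phi : {rmorphism R -> S}) (N : lmodType R).
Variables (G : zmodType) (b : S -> N -> G).
Hypothesis bDl : forall a a' n, b (a + a') n = b a n + b a' n.
Hypothesis bDr : forall a n n', b a (n + n') = b a n + b a n'.
Hypothesis b_bal : forall a r n, b (a * phi r) n = b a (r *: n).

Fixpoint tens_lift_term (s : tens_term S N) : G :=
  match s with
  | TensPure a n => b a n
  | TensZero => 0
  | TensOpp s => - tens_lift_term s
  | TensAdd s t => tens_lift_term s + tens_lift_term t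
  end.

Lemma tens_lift_eq s t : tens_eq phi s t -> tens_lift_term s = tens_lift_term t.
Proof.
elim=> //=.
- by move=> s1 t1 u _ -> _ ->.
- by move=> s1 t1 _ ->.
- by move=> s1 s' t1 t' _ -> _ ->.
- by move=> *; rewrite addrA.
- by move=> *; rewrite addrC.
- by move=> *; rewrite add0r.
- by move=> *; rewrite addNr.
Qed.

(** Universal property of the tensor product over [R]. The target is a mere abelian group;
    compatibility with scalars is recovered afterwards in [ind_hom]. *)
Lemma tens_lift : exists h : {additive tens phi N -> G},
  forall a n, h (pure phi a n) = b a n.
Proof.
pose h (u : tens phi N) := tens_lift_term (repr u).
have hE s : h (\pi_(tens phi N)%qT s) = tens_lift_term s.
  exact/tens_lift_eq/tens_reprK.
have hD : {morph h : u v / u + v}.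
  by elim/quotW => s; elim/quotW => t; rewrite -tens_piD !hE.
have hB : zmod_morphism h.
  by move=> u v; apply: (addIr (h v)); rewrite -hD !subrK.
pose H := GRing.isZmodMorphism.Build _ _ h hB.
exists (HB.pack_for {additive tens phi N -> G} h H) => a n.
exact: hE.
Qed.
End TensorLift.

Section InducedModule.
Variables (F : numFieldType) (P L : lieAlgType F) (f : lieHom P L).
Variable W : lieModule P.
Local Notation V := (ind_mod f W).

(** Frobenius reciprocity, obtained by lifting the map sending a pure tensor of [a] and [w] to [a]
    acting on [phi w]. All later proofs that a vector is nonzero go through it. *)
Lemma ind_hom (M : lieModule L) (phi : {linear W -> M}) :
  (forall x w, phi (lact x w) = lact (f x) (phi w)) ->
  exists h : {linear V -> M},
    (forall x u, h (lact x u) = lact x (h u)) /\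
    (forall w, h (ind_top f w) = phi w).
Proof.
move=> phi_act.
pose b (a : env L) (w : env_mod W) : M := env_act (M := M) a (phi w).
(* The hypothesis on elements of [P] propagates to all enveloping terms; this is the balancedness
   required by the lift. *)
have map_act t (w : W) :
    env_act (M := M) (env_map_term f t) (phi w) = phi (env_act_term t w).
  elim: t w => /= [x|a|s hs t ht|s hs t ht] w.
  - by rewrite env_actE /= phi_act.
  - by rewrite -env_constE env_actE /= linearZ.
  - by rewrite env_actDl hs ht linearD.
  - by rewrite -(env_actA (M := M)) ht hs.
have [||a r w|h hE] := @tens_lift _ _ (env_map f) (env_mod W) M b.
- by move=> a a' w; rewrite /b env_actDl.
- by move=> a w w'; rewrite /b -(env_actDr (M := M)); congr env_act; exact: linearD.
- rewrite /b -(env_actA (M := M)); congr env_act.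
  elim/quotW: r => r; rewrite /= env_mapE map_act; congr (phi _).
  exact/esym/env_actE.
have hZ (a : env L) (u : V) :
    h (a *: (u : tens (env_map f) (env_mod W))) = env_act (M := M) a (h u).
  elim/tens_ind: u => [e w||u hu|u v hu hv].
  - by rewrite scale_pure !hE /b (env_actA (M := M)).
  - by rewrite scaler0 raddf0; exact/esym/(scaler0 (env_mod M)).
  - by rewrite scalerN !raddfN hu; exact/esym/(scalerN (V := env_mod M)).
  - by rewrite scalerDr !raddfD hu hv; exact/esym/(env_actDr (M := M)).
have h_lin : linear (h : V -> M).
  move=> a u v; rewrite raddfD; congr (_ + _).
  rewrite -[a *: u]/((a%:A : env L) *: (u : tens (env_map f) (env_mod W))) hZ.
  by rewrite -env_constE env_actE.
pose H := GRing.isLinear.Build _ _ _ _ (h : V -> M) h_lin.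
exists (HB.pack_for {linear V -> M} (h : V -> M) H); split => /= [x u|w].
  by rewrite (hZ (env_gen x) u) env_actE.
by rewrite hE /b env_act1.
Qed.

Lemma ind_top_linear : linear (ind_top f (W := W) : W -> V).
Proof.
move=> a u v; rewrite /ind_top.
have -> : (a *: u + v : W) = ((env_const P a *: (u : env_mod W)) + v : env_mod W).
  by congr (_ + _); exact/esym/env_actE.
rewrite pureDr; congr (_ + _).
rewrite -pure_balanced mul1r /=.
have -> : env_map f (env_const P a) = a%:A by rewrite env_mapE.
rewrite -[RHS]/((a%:A : env L) *: pure (env_map f) (1 : env L) (u : env_mod W)).
by rewrite scale_pure mulr1.
Qed.

HB.instance Definition _ :=
  GRing.isLinear.Build F W V _ (ind_top f (W := W)) ind_top_linear.

(** The induction principle for the induced module: it is generated by its top, so stability under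
    linear combinations and the action suffices. *)
Lemma ind_generated (Q : V -> Prop) :
  (forall a u v, Q u -> Q v -> Q (a *: u + v)) ->
  (forall x u, Q u -> Q (lact x u)) ->
  (forall w, Q (ind_top f w)) -> forall u, Q u.
Proof.
move=> Qlin Qact Qtop.
have Q0 : Q 0.
  have := Qlin (-1) _ _ (Qtop 0) (Qtop 0).
  by rewrite scaleN1r addNr.
have Qenv (a : env L) (u : V) : Q u -> Q (a *: (u : tens (env_map f) (env_mod W))).
  elim/quotW: a => t; elim: t u => /= [x|a|s hs t ht|s hs t ht] u Qu.
  - exact: (Qact x u).
  - by have := Qlin a u 0 Qu Q0; rewrite addr0 /(_ *: _) /= /env_restr_scale -env_constE.
  - rewrite env_piD scalerDl; have := Qlin 1 _ _ (hs _ Qu) (ht _ Qu).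
    by rewrite scale1r.
  - by rewrite env_piM -scalerA; apply: hs; exact: ht.
elim/tens_ind => [a w||u Qu|u v Qu Qv].
- by rewrite -[a]mulr1 -scale_pure; exact/Qenv/Qtop.
- exact: Q0.
- by have := Qlin (-1) (u : V) 0 Qu Q0; rewrite addr0 scaleN1r.
- by have := Qlin 1 (u : V) v Qu Qv; rewrite scale1r.
Qed.
End InducedModule.

Section ModuleSums.
Variables (F : numFieldType) (V : lmodType F).
Implicit Types f : int -> V.

Lemma isum_scale a f : fin_supp f -> isum (fun j => a *: f j) = a *: isum f.
Proof. exact: (isum_map (f := f) [the {additive V -> V} of *:%R a]). Qed.

Lemma isum_scalel (v : V) (k : int -> F) : fin_supp k ->
  isum (fun j => k j *: v) = isum k *: v.
Proof.
move=> [N kN]; rewrite !(@isumE _ N) ?scaler_suml // => j jN.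
by rewrite kN ?scale0r.
Qed.

Lemma fin_supp_scale a f : fin_supp f -> fin_supp (fun j => a *: f j).
Proof. exact: fin_supp_map (scaler0 _ a). Qed.
End ModuleSums.

Section ActionSums.
Variables (F : numFieldType) (L : lieAlgType F) (M : lieModule L).
Implicit Types f : int -> M.

Lemma isum_lact x f : fin_supp f ->
  isum (fun j => lact x (f j)) = lact x (isum f).
Proof. exact: (isum_map (f := f) [the {additive M -> M} of lact x]). Qed.

Lemma fin_supp_lact x f : fin_supp f -> fin_supp (fun j => lact x (f j)).
Proof. exact: fin_supp_map (linear0 (lact x)). Qed.
End ActionSums.

(** * Loop modes at a fixed level and the grading of the induced module *)

Section Level.
Variables (F : numFieldType) (g : quadLieAlgType F) (M : lieModule (affine g)).
Variable l : F.
Hypothesis level : forall u : M, lact (central g) u = l *: u.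

Lemma lact_loopC x y m n (u : M) :
  lact (loop x m) (lact (loop y n) u) =
  lact (loop y n) (lact (loop x m) u) + lact (loop (lie x y) (m + n)) u
  + (if m + n == 0 then m%:~R * iform x y * l else 0) *: u.
Proof.
rewrite -[LHS](subrK (lact (loop y n) (lact (loop x m) u))) -lact_lie.
rewrite [lie _ _](affine_lie_loop x y m n) lactDl lactZl level scalerA addrC -addrA.
by case: eqP => // _; rewrite mul0r.
Qed.

Lemma lact_submod (N : M -> Prop) :
  (forall u v, N u -> N v -> N (u + v)) -> (forall a u, N u -> N (a *: u)) ->
  (forall x m u, N u -> N (lact (loop x m) u)) ->
  forall x u, N u -> N (lact x u).
Proof.
move=> ND NZ Nl x u Nu; elim/affine_ind: x => [x y Nx Ny|x m|c].
- by rewrite lactDl; exact: ND.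
- exact: Nl.
- by rewrite lactZl level; exact/NZ/NZ.
Qed.
End Level.

Section GradedInduced.
Variables (F : numFieldType) (g : quadLieAlgType F) (W : lieModule g) (l : F).
Local Notation V := (ind_mod (ge0_incl g) (ge0_mod W l)).
Local Notation top := (ind_top (ge0_incl g) (W := ge0_mod W l)).

Lemma lact_loop_top x m w : 0 <= m ->
  lact (loop x m) (top w) = if m == 0 then top (lact x w) else 0.
Proof.
move=> m0; have xm := loop_ge0 x m0.
rewrite -[loop x m]/(ge0_incl g (AffineGe0 xm)) lact_ind_top /= /ge0_act /=.
rewrite mulr0 scale0r addr0 mcoeffU; case: eqP => _ //.
by rewrite lact0l linear0.
Qed.

Lemma lact_central (u : V) : lact (central g) u = l *: u.
Proof.
elim/ind_generated: u => [a u v hu hv|x u hu|w].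
- by rewrite lact_linearr hu hv scalerDr !scalerA mulrC.
- apply/eqP; rewrite -linearZ -hu -subr_eq0 -lact_lie.
  by rewrite -[central g]scale1r [lie _ _](affine_lie_centrall 1 x) lact0l.
- have cg := central_ge0 g.
  rewrite -[central g]/(ge0_incl g (AffineGe0 cg)) lact_ind_top /= /ge0_act /=.
  rewrite mcoeff0 lact0l add0r mulr1. exact: linearZ.
Qed.

(** Only strictly negative modes are allowed here, unlike in [homog]. That nothing is lost is the
    spanning half of the Poincare-Birkhoff-Witt theorem. *)
Inductive neg_homog : int -> V -> Prop :=
  | neg_homog_top w : neg_homog 0 (top w)
  | neg_homog_lin n a u v : neg_homog n u -> neg_homog n v -> neg_homog n (a *: u + v)
  | neg_homog_0 n : neg_homog n 0
  | neg_homog_loop n x m v : m < 0 -> neg_homog n v ->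
      neg_homog (n - m) (lact (loop x m) v).

Lemma neg_homogZ n a u : neg_homog n u -> neg_homog n (a *: u).
Proof.
by move=> hu; have := neg_homog_lin a hu (neg_homog_0 n); rewrite addr0.
Qed.

Lemma neg_homogD n u v : neg_homog n u -> neg_homog n v -> neg_homog n (u + v).
Proof. by move=> hu hv; have := neg_homog_lin 1 hu hv; rewrite scale1r. Qed.

(** A mode is moved to the right through a word in negative modes until it meets the top. Each
    commutator is a single mode acting on a shorter word, so the induction hypothesis must be
    uniform in the mode. *)
Lemma neg_homog_loopW n x m u : neg_homog n u -> neg_homog (n - m) (lact (loop x m) u).
Proof.
move=> hu; elim: hu x m => {n u} [w|n a u v hu IHu hv IHv|n|n y p v p0 hv IH] x m.
- case: (ltgtP m 0) => [m0|m0|->].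
  + by apply: neg_homog_loop => //; exact: neg_homog_top.
  + by rewrite lact_loop_top ?ltW // gt_eqF //; exact: neg_homog_0.
  + by rewrite lact_loop_top // subr0; exact: neg_homog_top.
- by rewrite lact_linearr; apply: neg_homog_lin; [exact: IHu|exact: IHv].
- by rewrite linear0; exact: neg_homog_0.
(* Three terms: the swapped product, the bracket mode, and the central term, which occurs only for
   [m + p = 0] and then has the right degree. *)
- rewrite (lact_loopC lact_central) -[X in neg_homog _ X]addrA; apply: neg_homogD.
    by rewrite addrAC; apply: neg_homog_loop => //; exact: IH.
  apply: neg_homogD; first by rewrite -addrA -opprD (addrC p); exact: IH.
  case: eqP => [mp|_]; last by rewrite scale0r; exact: neg_homog_0.
  by rewrite -addrA -opprD (addrC p) mp subr0; exact: neg_homogZ.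
Qed.

Lemma homog_neg n (u : V) : homog n u -> neg_homog n u.
Proof.
elim=> {n u} [w|n|n a u v _ hu _ hv|n x m v _ hv|n v _ hv].
- exact: neg_homog_top.
- exact: neg_homog_0.
- exact: neg_homog_lin.
- exact: neg_homog_loopW.
- by rewrite lact_central; exact: neg_homogZ.
Qed.

(** In words of negative modes every letter raises the degree by at least 1, so a word of degree at
    most 0 is empty. *)
Lemma homog_le0 n u : homog n u ->
  (n < 0 -> u = 0) /\ (n = 0 -> exists w, u = top w).
Proof.
move/homog_neg; suff H : neg_homog n u ->
    (n < 0 -> u = 0) /\ (n = 0 -> exists w, u = top w) by [].
elim=> {n u} [w|n a u v _ [u0 ut] _ [v0 vt]|n|n x m v m0 _ [v0 vt]].
- by split=> // _; exists w.
- split=> n0; first by rewrite u0 // v0 // scaler0 addr0.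
  have [w ->] := ut n0; have [w' ->] := vt n0.
  by exists (a *: w + w'); rewrite ind_top_linear.
- by split=> // _; exists 0; rewrite linear0.
- split=> nm; rewrite v0 ?linear0 //; try lia.
  by exists 0; rewrite linear0.
Qed.

Lemma homog_lt0 n (u : V) : homog n u -> n < 0 -> u = 0.
Proof. by case/homog_le0. Qed.

Lemma homog0_top u : homog 0 u -> exists w, u = top w.
Proof. by case/homog_le0 => _; exact. Qed.

Lemma homog_decomp (u : V) : exists w : int -> V,
  [/\ fin_supp w, forall n, homog n (w n) & u = isum w].
Proof.
elim/ind_generated: u => [a u v [wu [fu hu ->]] [wv [fv hv ->]]|x u hu|w].
- have fau : fin_supp (fun n => a *: wu n) by exact: fin_supp_scale.
  exists (fun n => a *: wu n + wv n); split.
  + exact: fin_suppD.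
  + by move=> n; exact: homog_lin.
  + by rewrite isum_add // isum_scale.
- move: x u hu; apply: (@lact_submod _ _ _ l).
  + exact: lact_central.
  + move=> u v [wu [fu hu ->]] [wv [fv hv ->]]; exists (fun n => wu n + wv n); split.
    * exact: fin_suppD.
    * by move=> n; rewrite -[wu n]scale1r; exact: homog_lin.
    * by rewrite isum_add.
  + move=> a u [wu [fu hu ->]]; exists (fun n => a *: wu n); split.
    * exact: fin_supp_scale.
    * by move=> n; rewrite -[_ *: _]addr0; apply: homog_lin => //; exact: homog_0.
    * by rewrite isum_scale.
  + move=> x m u [wu [fu hu ->]]; exists (fun n => lact (loop x m) (wu (n + m))); split.
    * by apply: fin_supp_lact; exact: fin_supp_shift.
    * by move=> n; have := homog_loop x m (hu (n + m)); rewrite addrK.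
    * rewrite isum_lact ?isum_shift //.
      exact: fin_supp_shift.
- exists (fun n => if n == 0 then top w else 0); split.
  + by apply: (@fin_supp_single _ _ 0) => j /negPf ->.
  + by move=> n; case: eqP => [->|_]; [exact: homog_top|exact: homog_0].
  + by rewrite (@isum_single _ _ 0) // => j /negPf ->.
Qed.

(** A mode beyond the largest degree occurring in [u] lands in negative degree, where everything
    vanishes. This makes the normally ordered sums finite on each vector. *)
Lemma smooth (u : V) : exists N, forall x (n : int), N%:Z < n -> lact (loop x n) u = 0.
Proof.
have [w [[N wN] hw ->]] := homog_decomp u.
exists N => x n nN; rewrite -isum_lact.
  apply: isum0 => j; have [jN|jN] := ltnP N `|j|; first by rewrite wN ?linear0.
  by apply: (homog_lt0 (homog_loop x n (hw j))); lia.
by exists N.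
Qed.
End GradedInduced.

(** * Level zero: reducibility and the one-dimensional quotient *)

Section Irreducibility.
Variables (F : numFieldType) (L : lieAlgType F) (M : lieModule L).

Lemma one_dim_irreducible (f : {linear M -> F^o}) : bijective f -> irreducible M.
Proof.
move=> [f' fK f'K]; split.
  by exists (f' 1); apply: contra_neq (oner_neq0 F) => /(congr1 f); rewrite f'K linear0.
move=> N; have [[u [Nu u0]]|N0] := pselect (exists u, N u /\ u <> 0).
  right; apply/seteqP; split=> // v _.
  have fu0 : f u != 0 by apply/eqP => fu; apply: u0; rewrite -[u]fK fu -(linear0 f) fK.
  rewrite (_ : v = (f v / f u : F) *: u); first exact: submodZ.
  by apply: (can_inj fK); rewrite linearZ /= /GRing.scale /= divfK.
left; apply/seteqP; split=> [u Nu|u ->]; last exact: submod_set0.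
by apply: contrapT => u0; apply: N0; exists u.
Qed.
End Irreducibility.

Section TopVector.
Variables (F : numFieldType) (l dd : F).
Local Notation V := (VhatH4 l dd).
Local Notation top := (ind_top (ge0_incl (H4 F)) (W := ge0_mod (H4_char dd) l)).

Lemma top_generates (N : submodule V) c : c != 0 -> N (top c) -> forall u, N u.
Proof.
move=> c0 Nc; apply: ind_generated; [exact: submod_linear|exact: submod_lact|].
move=> w; rewrite (_ : w = (w / c : F) *: (c : F^o)); last by rewrite /GRing.scale /= divfK.
by rewrite linearZ; exact: submodZ.
Qed.

End TopVector.

Section LevelZero.
Variables (F : numFieldType) (dd : F).
Local Notation V := (VhatH4 0 dd).
Local Notation top := (ind_top (ge0_incl (H4 F)) (W := ge0_mod (H4_char dd) 0)).

(** The derived algebra of H4 is spanned by a, b, c; hence linear functions of the d-components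
    alone define one-dimensional modules at level 0. *)
Lemma affine_lie_jd (u v : affine (H4 F)) m : (lie u v).1@_m 0 jd = 0.
Proof.
rewrite /= raddf_sum summxE big1 // => i _.
rewrite raddf_sum summxE big1 // => j _.
by rewrite /= mcoeffU; case: eqP => _; rewrite ?mulr0n ?mulr1n !mxE //= !mulr0 subr0 addr0.
Qed.

(* At level 0 every d (x) t^m may act on a line by an arbitrary scalar, the
   commutators having no d-component; here only m = 0 and m = -1 are used. *)
Definition shift_char_act (u : affine (H4 F)) (v : F^o) : F^o :=
  (dd * u.1@_0 0 jd + u.1@_(-1) 0 jd) * v.

Fact shift_char_linearl v : linear (shift_char_act^~ v).
Proof.
move=> k x y; rewrite /shift_char_act /= !mcoeffD !laurent_coefZ !mxE.
by rewrite /GRing.scale /=; ring.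
Qed.
Fact shift_char_linearr x : linear (shift_char_act x).
Proof. by move=> k u v; rewrite /shift_char_act /GRing.scale /=; ring. Qed.
Fact shift_char_lie x y v : shift_char_act (lie x y) v
  = shift_char_act x (shift_char_act y v) - shift_char_act y (shift_char_act x v).
Proof.
rewrite {1}/shift_char_act !affine_lie_jd mulr0 addr0 mul0r /shift_char_act.
by ring.
Qed.
Definition shift_char : lieModule (affine (H4 F)) :=
  LieModule shift_char_linearl shift_char_linearr shift_char_lie.

Lemma lact_level0 : lact (loop (H4d F) (-1)) (top 1) != 0 :> V.
Proof.
have id_act (u : affine_ge0 (H4 F)) (w : F^o) :
    idfun (ge0_act (W := H4_char dd) 0 u w) = shift_char_act (ge0_incl _ u) (idfun w).
  rewrite /ge0_act /shift_char_act /= mul0r scale0r addr0.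
  (* The extra character value sits on mode -1, invisible to the nonnegative part, so the
     restriction is still the module being induced. *)
  by rewrite (aff_ge0P _ (valP u) (-1)) // [X in _ + X]mxE addr0.
have [h [h_act h_top]] := @ind_hom _ _ _ (ge0_incl (H4 F))
  (ge0_mod (H4_char dd) 0) shift_char [the {linear F^o -> F^o} of idfun] id_act.
apply: contra_neq (oner_neq0 F) => /(congr1 h).
rewrite linear0 h_act h_top /= /shift_char_act /= => /eqP.
by rewrite !mcoeffU eqxx !mxE /= mulr0 add0r mulr1 => /eqP.
Qed.

Lemma level0_hom : exists eps : {linear V -> hatH4_char dd},
  (forall x u, eps (lact x u) = lact x (eps u)) /\ (forall w, eps (top w) = w).
Proof.
have id_act (u : affine_ge0 (H4 F)) (w : F^o) :
    idfun (ge0_act (W := H4_char dd) 0 u w) = hatH4_char_act dd (ge0_incl _ u) (idfun w).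
  by rewrite /ge0_act /= mul0r scale0r addr0.
exact: (@ind_hom _ _ _ (ge0_incl (H4 F))
  (ge0_mod (H4_char dd) 0) (hatH4_char dd) [the {linear F^o -> F^o} of idfun] id_act).
Qed.

Variable eps : {linear V -> hatH4_char dd}.
Hypothesis eps_act : forall x u, eps (lact x u) = lact x (eps u).
Hypothesis eps_top : forall w, eps (top w) = w.

Lemma eps_linear_ker a u v : eps u = 0 -> eps v = 0 -> eps (a *: u + v) = 0.
Proof. by move=> u0 v0; rewrite linearP /= u0 v0 scaler0 addr0. Qed.

Lemma eps_lact_ker x u : eps u = 0 -> eps (lact x u) = 0.
Proof. by move=> u0; rewrite eps_act u0 linear0. Qed.

Definition eps_ker : submodule V :=
  @Submodule _ _ V (fun u => eps u = 0) (linear0 eps) eps_linear_ker eps_lact_ker.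

Lemma eps_homog n u : homog n u -> n != 0 -> eps u = 0.
Proof.
elim=> {n u} [w|n|n a u v _ hu _ hv|n x m v _ hv|n v _ hv] n0.
- by rewrite eqxx in n0.
- exact: linear0.
- by apply: eps_linear_ker; [exact: hu|exact: hv].
- rewrite eps_act /= /hatH4_char_act /H4_char_act /= mcoeffU.
  have [m0|m0] := eqVneq m 0; last by rewrite mxE mulr0 mul0r.
  by rewrite hv ?mulr0 //; move: n0; rewrite m0 subr0.
- by rewrite (lact_central v) scale0r linear0.
Qed.

(** [eps] kills every component of nonzero degree, so its value on [u] is its value on the degree 0
    component, and all components of a kernel element lie in the kernel. *)
Lemma eps_ker_graded : graded_submod eps_ker.
Proof.
move=> u; have [w [[N wN] hw ->]] := homog_decomp u => Ju.
have w0 : eps (w 0) = 0.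
  have fw : fin_supp w by exists N.
  rewrite -[RHS](etrans (isum_map (eps : {additive V -> hatH4_char dd}) fw) Ju).
  by rewrite (@isum_single _ _ 0) // => j; exact: eps_homog.
exists [seq i%:Z - N%:Z | i <- iota 0 N.*2.+1], w; split=> [n|].
  split=> //=; have [->//|n0] := eqVneq n 0.
  exact: eps_homog (hw n) n0.
by rewrite (isumE wN) big_map -(big_mkord xpredT (fun i => w (i%:Z - N%:Z))).
Qed.

Lemma eps_ker_largest : largest_graded eps_ker.
Proof.
split; first exact: eps_ker_graded.
  by exists (top 1); rewrite /= eps_top; apply/eqP/oner_neq0.
move=> N Ngr [v0 Nv0] v /Ngr [r [w [hw ->]]] /=.
rewrite linear_sum big1 // => n _; have [hn Nn] := hw n.
have [n0|] := eqVneq n 0; last exact: eps_homog hn.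
(* The degree 0 component is a multiple of the top vector and lies in [N]; a nonzero multiple would
   generate the whole module. *)
move: hn Nn; rewrite n0 => /homog0_top [c ->] Nc; rewrite eps_top.
by apply/eqP; apply: contra_notT Nv0 => c0; exact: top_generates Nc _.
Qed.

Lemma eps_quot : exists f : {linear quot_mod eps_ker -> hatH4_char dd},
  bijective f /\ forall x v, f (lact x v) = lact x (f v).
Proof.
pose f (q : quot eps_ker) : hatH4_char dd := eps (repr q).
have fE u : f (\pi_(quot eps_ker)%qT u) = eps u.
  apply/eqP; rewrite -subr_eq0 -linearB; apply/eqP.
  exact: (quot_reprK eps_ker u).
have f_lin : linear (f : quot_mod eps_ker -> _).
  move=> a; elim/quotW => u; elim/quotW => v.
  by rewrite -quot_piZ -quot_piD !fE linearP.
pose H := GRing.isLinear.Build _ _ _ _ (f : quot_mod eps_ker -> hatH4_char dd) f_lin.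
exists (HB.pack_for {linear quot_mod eps_ker -> hatH4_char dd}
  (f : quot_mod eps_ker -> hatH4_char dd) H); split.
  exists (fun w => \pi_(quot eps_ker)%qT (top w)) => /=.
    elim/quotW => u; rewrite fE; apply: quot_pi => /=.
    by rewrite linearB /= eps_top subrr.
  by move=> w; rewrite fE eps_top.
by move=> x; elim/quotW => u /=; rewrite quot_actE !fE eps_act.
Qed.
End LevelZero.

Lemma level0_quotient (F : numFieldType) (dd : F) :
  exists J : submodule (VhatH4 0 dd),
    [/\ largest_graded J, irreducible (quot_mod J) &
        lie_isomorphic (quot_mod J) (hatH4_char dd)].
Proof.
have [eps [eps_act eps_top]] := level0_hom dd.
have [f [f_bij f_act]] := eps_quot eps_act eps_top.
exists (eps_ker eps_act); split; first exact: eps_ker_largest.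
  exact: one_dim_irreducible f_bij.
by exists f.
Qed.

Lemma level0_reducible (F : numFieldType) (dd : F) : ~ irreducible (VhatH4 0 dd).
Proof.
have [eps [eps_act eps_top]] := level0_hom dd.
have mem (S : VhatH4 0 dd -> Prop) u : eps_ker eps_act = S :> (_ -> Prop) -> eps u = 0 -> S u.
  by move=> <-.
case=> _ /(_ (eps_ker eps_act)) [/mem J|J].
  (* The witness d (x) t^-1 applied to the top has degree 1, so it is a nonzero kernel element; the
     top vector shows that the kernel is proper. *)
  have /eqP := lact_level0 dd; apply; apply: J.
  apply: (eps_homog eps_act (n := 1)) => //.
  exact: (homog_loop _ (-1) (homog_top _)).
have := eps_top 1; suff -> : eps (ind_top (W := ge0_mod (H4_char dd) 0) _ 1) = 0.
  by move/eqP; rewrite eq_sym oner_eq0.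
by rewrite -[_ = 0]/(submod_set (eps_ker eps_act) _) J.
Qed.

(** * The Sugawara operator *)

Section LoopLinear.
Variables (F : numFieldType) (g : quadLieAlgType F) (M : lieModule (affine g)).

Lemma loopZ (k : F) (x : g) m : loop (k *: x) m = k *: loop x m.
Proof. by rewrite /loop laurent_monomZ; congr (_, _); rewrite scaler0. Qed.

Lemma lactDr (x : affine g) (u v : M) : lact x (u + v) = lact x u + lact x v.
Proof. exact: linearD. Qed.

Lemma lactZr (x : affine g) k (u : M) : lact x (k *: u) = k *: lact x u.
Proof. exact: linearZ. Qed.

Lemma lactNr (x : affine g) (u : M) : lact x (- u) = - lact x u.
Proof. exact: linearN. Qed.

Lemma lactNl (x : affine g) (u : M) : lact (- x) u = - lact x u.
Proof. by rewrite -[in LHS]scaleN1r lactZl scaleN1r. Qed.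

Lemma lact_lieC (x y : affine g) (u : M) : lact (lie x y) u = - lact (lie y x) u.
Proof. by rewrite !lact_lie opprB. Qed.

Lemma lact_comm2 (x y z : affine g) (u : M) :
  lact x (lact y (lact z u)) - lact z (lact x (lact y u)) =
  lact x (lact (lie y z) u) + lact (lie x z) (lact y u).
Proof. by rewrite !lact_lie linearB /= addrA subrK. Qed.
End LoopLinear.

Section Sugawara.
Variables (F : numFieldType) (l : F) (M : lieModule (affine (H4 F))).
Hypothesis level : forall u : M, lact (central (H4 F)) u = l *: u.
Hypothesis M_smooth : forall u : M,
  exists N, forall x (n : int), N%:Z < n -> lact (loop x n) u = 0.
Hypothesis c0_act : forall u : M, lact (loop (H4c F) 0) u = 0.

Local Notation a := (H4a F).
Local Notation b := (H4b F).
Local Notation c := (H4c F).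
Local Notation d := (H4d F).
Local Notation A m := (lact (loop a m) : M -> M).
Local Notation B m := (lact (loop b m) : M -> M).
Local Notation C m := (lact (loop c m) : M -> M).
Local Notation D m := (lact (loop d m) : M -> M).
Implicit Types (u v : M) (m n j : int).

Lemma H4_span (x : H4 F) :
  x = x 0 ja *: a + x 0 jb *: b + x 0 jc *: c + x 0 jd *: d.
Proof.
by apply/rowP => -[[|[|[|[|//]]]]] p; rewrite !mxE /=;
  rewrite !mulr0 !mulr1 ?addr0 ?add0r; congr (x _ _); apply: val_inj.
Qed.

Lemma H4_loop_ind (Q : affine (H4 F) -> Prop) m :
  (forall k x y, Q x -> Q y -> Q (k *: x + y)) -> Q 0 ->
  Q (loop a m) -> Q (loop b m) -> Q (loop c m) -> Q (loop d m) ->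
  forall x, Q (loop x m).
Proof.
move=> Qlin Q0 Qa Qb Qc Qd x; rewrite (H4_span x) !loopD !loopZ.
have QZ k y : Q y -> Q (k *: y) by move=> Qy; rewrite -[_ *: y]addr0; exact: Qlin.
have QD y z : Q y -> Q z -> Q (y + z).
  by move=> Qy Qz; rewrite -[y]scale1r; exact: Qlin.
exact: (QD _ _ (QD _ _ (QD _ _ (QZ _ _ Qa) (QZ _ _ Qb)) (QZ _ _ Qc)) (QZ _ _ Qd)).
Qed.

Let lie_loop x y m n u : lact (lie (loop x m) (loop y n)) u =
  lact (loop (lie x y) (m + n)) u
  + (if m + n == 0 then m%:~R * iform x y * l else 0) *: u.
Proof.
rewrite [lie _ _](affine_lie_loop x y m n) lactDl lactZl level scalerA.
by case: eqP => // _; rewrite mul0r.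
Qed.

Lemma lie_aa m n u : lact (lie (loop a m) (loop a n)) u = 0.
Proof.
rewrite lie_loop lie_alt loop0 lact0l add0r; have [[_ _ -> _ _] _] := H4_forms F.
by rewrite mulr0 mul0r if_same scale0r.
Qed.
Lemma lie_bb m n u : lact (lie (loop b m) (loop b n)) u = 0.
Proof.
rewrite lie_loop lie_alt loop0 lact0l add0r; have [[_ _ _ -> _] _] := H4_forms F.
by rewrite mulr0 mul0r if_same scale0r.
Qed.
Lemma lie_cc m n u : lact (lie (loop c m) (loop c n)) u = 0.
Proof.
rewrite lie_loop lie_alt loop0 lact0l add0r; have [[_ _ _ _ ->] _] := H4_forms F.
by rewrite mulr0 mul0r if_same scale0r.
Qed.
Lemma lie_dd m n u : lact (lie (loop d m) (loop d n)) u = 0.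
Proof.
rewrite lie_loop lie_alt loop0 lact0l add0r; have [_ [-> _ _ _ _]] := H4_forms F.
by rewrite mulr0 mul0r if_same scale0r.
Qed.
Lemma lie_ca m n u : lact (lie (loop c m) (loop a n)) u = 0.
Proof.
rewrite lie_loop; have [_ [_ -> _]] := H4_brackets F.
have [_ [_ ac _ _ _]] := H4_forms F; rewrite iformC ac loop0 lact0l add0r.
by rewrite mulr0 mul0r if_same scale0r.
Qed.
Lemma lie_cb m n u : lact (lie (loop c m) (loop b n)) u = 0.
Proof.
rewrite lie_loop; have [_ [_ _ ->]] := H4_brackets F.
have [_ [_ _ _ bc _]] := H4_forms F; rewrite iformC bc loop0 lact0l add0r.
by rewrite mulr0 mul0r if_same scale0r.
Qed.
Lemma lie_ac m n u : lact (lie (loop a m) (loop c n)) u = 0.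
Proof. by rewrite lact_lieC lie_ca oppr0. Qed.
Lemma lie_bc m n u : lact (lie (loop b m) (loop c n)) u = 0.
Proof. by rewrite lact_lieC lie_cb oppr0. Qed.

Let dlt m n : F := if m + n == 0 then m%:~R * l else 0.
Let dltC m n : dlt n m = - dlt m n.
Proof.
rewrite /dlt addrC; case: eqP => [mn|_]; last by rewrite oppr0.
by rewrite -mulNr -rmorphN; congr (_%:~R * _); lia.
Qed.

Lemma lie_ab m n u :
  lact (lie (loop a m) (loop b n)) u = C (m + n) u + dlt m n *: u.
Proof.
rewrite lie_loop; have [[-> _ _] _] := H4_brackets F.
by have [[-> _ _ _ _] _] := H4_forms F; rewrite mulr1.
Qed.
Lemma lie_ba m n u :
  lact (lie (loop b m) (loop a n)) u = - C (m + n) u + dlt m n *: u.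
Proof.
rewrite lact_lieC lie_ab opprD -scaleNr -dltC.
by rewrite (addrC m).
Qed.
Lemma lie_da m n u : lact (lie (loop d m) (loop a n)) u = A (m + n) u.
Proof.
rewrite lie_loop; have [[_ -> _] _] := H4_brackets F.
have [_ [_ _ ad _ _]] := H4_forms F; rewrite iformC ad.
by rewrite mulr0 mul0r if_same scale0r addr0.
Qed.
Lemma lie_db m n u : lact (lie (loop d m) (loop b n)) u = - B (m + n) u.
Proof.
rewrite lie_loop; have [[_ _ ->] _] := H4_brackets F.
have [_ [_ _ _ _ bd]] := H4_forms F; rewrite iformC bd.
by rewrite mulr0 mul0r if_same scale0r addr0 loopN lactNl.
Qed.
Lemma lie_ad m n u : lact (lie (loop a m) (loop d n)) u = - A (m + n) u.
Proof. by rewrite lact_lieC lie_da addrC. Qed.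
Lemma lie_bd m n u : lact (lie (loop b m) (loop d n)) u = B (m + n) u.
Proof. by rewrite lact_lieC lie_db opprK addrC. Qed.
Lemma lie_cd m n u : lact (lie (loop c m) (loop d n)) u = dlt m n *: u.
Proof.
rewrite lie_loop; have [_ [-> _ _]] := H4_brackets F.
by have [[_ -> _ _ _] _] := H4_forms F; rewrite mulr1 loop0 lact0l add0r.
Qed.
Lemma lie_dc m n u : lact (lie (loop d m) (loop c n)) u = dlt m n *: u.
Proof. by rewrite lact_lieC lie_cd -scaleNr -dltC. Qed.

Lemma lact_commute x y u : lact (lie x y) u = 0 -> lact x (lact y u) = lact y (lact x u).
Proof. by rewrite lact_lie => /eqP; rewrite subr_eq0 => /eqP. Qed.

(** In either branch the factor applied first has mode [|j|], which gives finiteness on smooth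
    modules. At [j = 0] the mode of [y] acts first: for the pair a, b this is b_0. *)
Definition nord x y j u : M :=
  if 0 <= j then lact (loop x (- j)) (lact (loop y j) u)
  else lact (loop y j) (lact (loop x (- j)) u).

Lemma nord_linear x y j : linear (nord x y j).
Proof. by move=> k u v; rewrite /nord; case: ifP => _; rewrite !lact_linearr. Qed.

Lemma nord_fin x y u : fin_supp (nord x y ^~ u).
Proof.
have [N uN] := M_smooth u; exists N => j jN; rewrite /nord.
by case: ifP => j0; rewrite uN ?linear0 //; lia.
Qed.

Definition nsum x y u : M := isum (nord x y ^~ u).

Lemma nsum_linear x y : linear (nsum x y).
Proof.
move=> k u v; rewrite /nsum -isum_scale -?isum_add; last exact: nord_fin.
- by apply: eq_isum => j; exact: nord_linear.
- exact/fin_supp_scale/nord_fin.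
- exact: nord_fin.
Qed.

Lemma nsum_comm x y z u : nsum x y (lact z u) - lact z (nsum x y u) =
  isum (fun j => if 0 <= j
    then lact (loop x (- j)) (lact (lie (loop y j) z) u)
         + lact (lie (loop x (- j)) z) (lact (loop y j) u)
    else lact (loop y j) (lact (lie (loop x (- j)) z) u)
         + lact (lie (loop y j) z) (lact (loop x (- j)) u)).
Proof.
rewrite /nsum -isum_lact -?isum_sub; last exact: nord_fin.
- by apply: eq_isum => j; rewrite /nord; case: ifP => _; rewrite lact_comm2.
- exact: nord_fin.
- exact/fin_supp_lact/nord_fin.
Qed.

Lemma lact_pair_fin x y m u : (forall i j v, lact (lie (loop x i) (loop y j)) v = 0) ->
  fin_supp (fun j => lact (loop x (- j)) (lact (loop y (j + m)) u)).
Proof.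
move=> xy; have [N uN] := M_smooth u; exists (N + `|m|)%N => j jN.
have [j0|j0] := lerP 0 j; first by rewrite (uN y) ?linear0 //; lia.
by rewrite lact_commute // uN ?linear0 //; lia.
Qed.

(** The quadratic sum in a and c on the right cancels against the one from [nsum_cd_a]. Since the
    modes of a and c commute, it needs no ordering and leaves only the linear term. *)
Lemma nsum_ab_a n u : nsum a b (A n u) - A n (nsum a b u)
  = - isum (fun j => A (- j) (C (j + n) u)) - (n%:~R * l) *: A n u.
Proof.
rewrite nsum_comm [LHS](@eq_isum _ _ (fun j => - A (- j) (C (j + n) u) + dlt j n *: A (- j) u)).
  rewrite isum_add ?isum_opp; first congr (_ + _).
  - rewrite (@isum_single _ _ (- n)) /dlt; last first.
      by move=> j /negPf jn; rewrite addr_eq0 jn scale0r.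
    by rewrite addNr eqxx opprK -scaleNr rmorphN mulNr.
  - exact: (lact_pair_fin _ _ lie_ac).
  - exact: (fin_supp_opp (lact_pair_fin _ _ lie_ac)).
  - apply: (@fin_supp_single _ _ (- n)) => j /negPf jn.
    by rewrite /dlt addr_eq0 jn scale0r.
move=> j; case: ifP => _; rewrite lie_aa ?linear0 ?addr0 ?add0r lie_ba.
  by rewrite linearD linearN linearZ.
by rewrite (lact_commute (lie_ca _ _ _)).
Qed.

Lemma nsum_cd_a n u : nsum c d (A n u) - A n (nsum c d u)
  = isum (fun j => C (- j) (A (j + n) u)).
Proof.
rewrite nsum_comm; apply: eq_isum => j.
case: ifP => _; rewrite lie_ca ?linear0 ?addr0 ?add0r lie_da //.
by rewrite (lact_commute (lie_ca _ _ _)).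
Qed.

Lemma nsum_ab_b n u : nsum a b (B n u) - B n (nsum a b u)
  = isum (fun j => C (n - j) (B j u)) - (n%:~R * l) *: B n u.
Proof.
rewrite nsum_comm [LHS](@eq_isum _ _ (fun j => C (n - j) (B j u) + dlt (- j) n *: B j u)).
  rewrite isum_add; first congr (_ + _).
  - rewrite (@isum_single _ _ n) /dlt; last first.
      by move=> j /negPf jn; rewrite addrC subr_eq0 eq_sym jn scale0r.
    by rewrite addNr eqxx -scaleNr rmorphN mulNr.
  - have := fin_supp_shift (- n) (lact_pair_fin n u lie_cb).
    by apply: fin_supp_eq => j; rewrite subrK opprB.
  - apply: (@fin_supp_single _ _ n) => j /negPf jn.
    by rewrite /dlt addrC subr_eq0 eq_sym jn scale0r.
move=> j; rewrite (addrC n).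
case: ifP => _; rewrite lie_bb ?linear0 ?addr0 ?add0r lie_ab //.
by rewrite lactDr lactZr -(lact_commute (lie_cb _ _ _)).
Qed.

Lemma nsum_cd_b n u : nsum c d (B n u) - B n (nsum c d u)
  = - isum (fun j => C (n - j) (B j u)).
Proof.
rewrite nsum_comm -(isum_shift (fun j => C (n - j) (B j u)) n) -isum_opp.
  apply: eq_isum => j; rewrite opprD addrCA subrr addr0.
  case: ifP => _; rewrite lie_cb ?linear0 ?addr0 ?add0r lie_db ?linearN //.
  by rewrite (lact_commute (lie_cb _ _ _)).
have := lact_pair_fin n u lie_cb.
by apply: fin_supp_eq => j; rewrite opprD addrCA subrr addr0.
Qed.

Lemma nsum_ab_c n u : nsum a b (C n u) - C n (nsum a b u) = 0.
Proof.
rewrite nsum_comm isum0 // => j.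
by case: ifP => _; rewrite lie_ac lie_bc linear0 addr0.
Qed.

Lemma nsum_cc_c x n u : x \in [:: a; b; c] ->
  nsum c c (lact (loop x n) u) - lact (loop x n) (nsum c c u) = 0.
Proof.
move=> xabc; rewrite nsum_comm isum0 // => j.
have cx m v : lact (lie (loop c m) (loop x n)) v = 0.
  move: xabc; rewrite !inE => /or3P[] /eqP ->.
  - exact: lie_ca.
  - exact: lie_cb.
  - exact: lie_cc.
by case: ifP => _; rewrite !cx linear0 addr0.
Qed.

Lemma nsum_cd_c n u : nsum c d (C n u) - C n (nsum c d u) = - (n%:~R * l) *: C n u.
Proof.
rewrite nsum_comm (@isum_single _ _ (- n)).
  by rewrite opprK; case: ifP => _; rewrite lie_cc ?linear0 ?addr0 ?add0r lie_dc
    /dlt addNr eqxx rmorphN mulNr ?linearZ.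
move=> j; rewrite -subr_eq0 opprK => /negPf jn.
by case: ifP => _; rewrite lie_cc lie_dc /dlt jn scale0r ?linear0 addr0.
Qed.

Lemma nsum_cd_d n u : nsum c d (D n u) - D n (nsum c d u) = - (n%:~R * l) *: D n u.
Proof.
rewrite nsum_comm (@isum_single _ _ n).
  by case: ifP => _; rewrite lie_dd ?linear0 ?addr0 ?add0r lie_cd
    /dlt addNr eqxx rmorphN mulNr ?linearZ.
move=> j; rewrite -subr_eq0 -opprB oppr_eq0 => /negPf jn.
by case: ifP => _; rewrite lie_dd lie_cd /dlt (addrC (- j)) jn scale0r ?linear0 addr0.
Qed.

Lemma nsum_cc_d n u : nsum c c (D n u) - D n (nsum c c u)
  = - (n%:~R * l *+ 2) *: C n u.
Proof.
rewrite nsum_comm [LHS](@eq_isum _ _ (fun j => dlt j n *: C (- j) u + dlt (- j) n *: C j u)).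
  rewrite isum_add.
  - rewrite (@isum_single _ _ (- n)); last first.
      by move=> j /negPf jn; rewrite /dlt addr_eq0 jn scale0r.
    rewrite (@isum_single _ _ n); last first.
      by move=> j /negPf jn; rewrite /dlt addrC subr_eq0 eq_sym jn scale0r.
    by rewrite /dlt addNr eqxx opprK -scalerDl rmorphN mulNr mulr2n opprD.
  - apply: (@fin_supp_single _ _ (- n)) => j /negPf jn.
    by rewrite /dlt addr_eq0 jn scale0r.
  - apply: (@fin_supp_single _ _ n) => j /negPf jn.
    by rewrite /dlt addrC subr_eq0 eq_sym jn scale0r.
move=> j; case: ifP => _; rewrite !lie_cd ?linearZ //.
by rewrite addrC.
Qed.

(** The ordering anomaly: d has weights 1 and -1 on a and b, so the commutator is the difference of
    one series ordered at n and at 0. Moving the ordering point produces -n times the commutator of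
    the modes of a and b. *)
Lemma nsum_ab_d n u : nsum a b (D n u) - D n (nsum a b u) = - n%:~R *: C n u.
Proof.
pose E p j := if p <= j then A (n - j) (B j u) else B j (A (n - j) u).
have fE p : fin_supp (E p).
  have [N uN] := M_smooth u; exists (N + `|n| + `|p|)%N => j jN; rewrite /E.
  by case: ifP => j0; rewrite uN ?linear0 //; lia.
rewrite nsum_comm [LHS](@eq_isum _ _ (fun j => E n (j + n) - E 0 j)); last first.
  move=> j; rewrite /E lerDr opprD addrCA subrr addr0.
  case: ifP => _; rewrite lie_ad lie_bd ?lactNr (addrC n) //.
  by rewrite [LHS]addrC.
rewrite isum_sub //; last exact: fin_supp_shift.
rewrite isum_shift -isum_sub //.
have [fs <-] := isum_step F n.
rewrite -isum_scalel //.
apply: eq_isum => j; rewrite /E.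
(* For [n = 0] the two orderings agree; for [n != 0] the commutator of the modes of a and b has no
   central term. *)
have [->|n0] := eqVneq n 0; first by rewrite !subrr scale0r.
have AB : A (n - j) (B j u) - B j (A (n - j) u) = C n u.
  by rewrite -lact_lie lie_ab subrK /dlt subrK (negPf n0) scale0r addr0.
case: ifP => _; case: ifP => _; rewrite ?subrr ?subr0 ?sub0r ?scale0r ?scale1r //.
by rewrite scaleN1r -AB opprB.
Qed.

(* The Sugawara-type degree operator, valid on modules where c (x) t^0 acts as 0. *)
Definition sugawara u : M :=
  nsum a b u + nsum c d u - (2 * l)^-1 *: nsum c c u.

Lemma sugawara_linear : linear sugawara.
Proof.
move=> k u v; rewrite /sugawara !nsum_linear !scalerDr scalerA.
rewrite [_ * k]mulrC -scalerA scalerN opprD (addrACA (k *: nsum a b u)).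
exact: addrACA.
Qed.

Lemma sugawara0 : sugawara 0 = 0.
Proof. by have := sugawara_linear (-1) 0 0; rewrite scaler0 addr0 scaleN1r addNr. Qed.

(** For [j != 0] a positive mode acts first. At [j = 0] the products a_0 b_0 and c_0 c_0 vanish by
    their inner factor, and c_0 d_0 by its outer factor. *)
Lemma sugawara_singular u :
  (forall x n, 0 < n -> lact (loop x n) u = 0) -> B 0 u = 0 -> sugawara u = 0.
Proof.
move=> u_sing Bu; have H x y : lact (loop y 0) u = 0 -> nsum x y u = 0.
  move=> y0; apply: isum0 => j; rewrite /nord.
  case: (ltgtP j 0) => [j0|j0|->]; rewrite ?y0 ?u_sing ?linear0 //; lia.
rewrite /sugawara (H a b) // (H c c) // scaler0 subr0 add0r.
apply: isum0 => j; rewrite /nord.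
case: (ltgtP j 0) => [j0|j0|->]; rewrite ?oppr0 ?c0_act ?u_sing ?linear0 //; lia.
Qed.

Hypothesis l_neq0 : l != 0.

Lemma sugawara_comm x n u :
  sugawara (lact (loop x n) u) - lact (loop x n) (sugawara u)
  = - (n%:~R * l) *: lact (loop x n) u.
Proof.
have split z : sugawara (lact z u) - lact z (sugawara u) =
    (nsum a b (lact z u) - lact z (nsum a b u))
  + (nsum c d (lact z u) - lact z (nsum c d u))
  - (2 * l)^-1 *: (nsum c c (lact z u) - lact z (nsum c c u)).
  rewrite /sugawara lactDr lactDr lactNr lactZr scalerDr scalerN.
  by rewrite !opprD !opprK addrACA (addrACA (nsum a b (lact z u))).
apply: (@H4_loop_ind (fun z => sugawara (lact z u) - lact z (sugawara u)
    = - (n%:~R * l) *: lact z u)).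
- move=> k y z hy hz; rewrite !lact_linearl sugawara_linear opprD addrACA.
  by rewrite -scalerBr hy hz scalerDr !scalerA [k * _]mulrC.
- by rewrite !lact0l sugawara0 subr0 scaler0.
- rewrite split nsum_ab_a nsum_cd_a nsum_cc_c ?inE ?eqxx // scaler0 subr0.
  (* The reflection of j into -n - j matches the two quadratic sums in a and c. *)
  rewrite addrAC -(isum_reflect (fun j => C (- j) (A (j + n) u)) (- n)).
  rewrite (eq_isum (g := fun j => A (- j) (C (j + n) u))) ?addNr ?add0r ?scaleNr //.
  move=> j; have -> : - n - j + n = - j by lia.
  have -> : - (- n - j) = j + n by lia.
  exact: lact_commute (lie_ca _ _ _).
- rewrite split nsum_ab_b nsum_cd_b nsum_cc_c ?inE ?eqxx ?orbT // scaler0 subr0.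
  by rewrite addrAC subrr add0r scaleNr.
- rewrite split nsum_ab_c nsum_cd_c nsum_cc_c ?inE ?eqxx ?orbT // scaler0 subr0.
  by rewrite add0r.
- rewrite split nsum_ab_d nsum_cd_d nsum_cc_d scalerA addrAC -scaleNr -scalerDl.
  (* Here the coefficient [(2 * l)^-1] is fixed: the anomaly -n of the a b sum must cancel the
     contribution -2 n l of the c c sum. *)
  rewrite (_ : - n%:~R - _ = 0) ?scale0r ?add0r // mulrN opprK.
  by field; rewrite l_neq0.
Qed.

End Sugawara.

(** * Eigenvectors of the degree operator and submodules at nonzero level *)

Section EigenSums.
Variables (F : numFieldType) (V : lmodType F) (T : V -> V) (l : F).
Hypothesis T_linear : linear T.
Hypothesis l_neq0 : l != 0.

Let T0 : T 0 = 0.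
Proof. by have := T_linear (-1) 0 0; rewrite scaler0 addr0 scaleN1r addNr. Qed.

Let T_sum (I : Type) (r : seq I) (w : I -> V) : T (\sum_(n <- r) w n) = \sum_(n <- r) T (w n).
Proof.
elim: r => [|n r IH]; first by rewrite !big_nil.
by rewrite !big_cons -[w n]scale1r T_linear IH !scale1r.
Qed.

Lemma linear_isum (w : int -> V) : fin_supp w -> T (isum w) = isum (fun n => T (w n)).
Proof.
by move=> [N wN]; rewrite !(@isumE _ N) ?T_sum // => j jN; rewrite wN ?T0.
Qed.

(** Subtracting [m l] times the relation from its image under [T] removes the head [m] and scales
    the other terms by the nonzero numbers (n - m) l. *)
Lemma eigen_sum_eq0 (r : seq int) (w : int -> V) : uniq r ->
  (forall n, T (w n) = (n%:~R * l) *: w n) -> \sum_(n <- r) w n = 0 ->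
  forall n, n \in r -> w n = 0.
Proof.
elim: r w => [//|m r IH] w /= /andP[mr ur] Tw s0.
have wr n : n \in r -> w n = 0.
  move=> nr; have nm : n%:~R - m%:~R != 0 :> F.
    by rewrite subr_eq0 eqr_int; apply: contra mr => /eqP <-.
  suff /eqP : ((n%:~R - m%:~R) * l) *: w n = 0.
    by rewrite scaler_eq0 mulf_eq0 (negPf nm) (negPf l_neq0) /= => /eqP.
  apply: (IH (fun k => ((k%:~R - m%:~R) * l) *: w k) ur _ _ n nr).
    move=> k; have := T_linear ((k%:~R - m%:~R) * l) (w k) 0.
    by rewrite T0 !addr0 => ->; rewrite Tw !scalerA mulrC.
  move/(congr1 T): (s0); rewrite T_sum T0 => Ts0.
  have : \sum_(k <- m :: r) T (w k) - (m%:~R * l) *: \sum_(k <- m :: r) w k = 0.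
    by rewrite Ts0 s0 scaler0 subr0.
  rewrite !big_cons Tw scalerDr opprD addrACA subrr add0r scaler_sumr -sumrB => {2}<-.
  by apply: eq_bigr => k _; rewrite Tw -scalerBl -mulrBl.
move=> n; rewrite inE => /orP[/eqP ->|]; last exact: wr.
by move: s0; rewrite big_cons big_seq big1 ?addr0.
Qed.

Lemma eigen_isum_eq0 (w : int -> V) : fin_supp w ->
  (forall n, T (w n) = (n%:~R * l) *: w n) -> isum w = 0 -> forall n, w n = 0.
Proof.
move=> [N wN] Tw; rewrite (isumE wN).
pose r := [seq i%:Z - N%:Z | i <- iota 0 N.*2.+1].
rewrite -(big_mkord xpredT (fun i => w (i%:Z - N%:Z))) /index_iota subn0.
rewrite -(big_map (fun i : nat => i%:Z - N%:Z) xpredT w) => s0 n.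
have [nN|nN] := ltnP N `|n|; first exact: wN.
apply: (@eigen_sum_eq0 r) => //.
  by rewrite map_inj_uniq ?iota_uniq // => i j; lia.
by apply/mapP; exists (absz (n + N%:Z)); [rewrite mem_iota|]; lia.
Qed.
End EigenSums.

Section LevelNonzero.
Variables (F : numFieldType) (l dd : F).
Hypothesis l_neq0 : l != 0.
Local Notation V := (VhatH4 l dd).
Local Notation top := (ind_top (ge0_incl (H4 F)) (W := ge0_mod (H4_char dd) l)).
Local Notation b0 := (lact (loop (H4b F) 0) : V -> V).

Let level (u : V) : lact (central (H4 F)) u = l *: u := lact_central u.

(** c is central in H4, and the central term of its bracket with d carries the mode number, here 0.
    So c_0 commutes with everything, and it kills the top. *)
Lemma c0_act_eq0 (u : V) : lact (loop (H4c F) 0) u = 0.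
Proof.
elim/ind_generated: u => [k u v hu hv|x u hu|w].
- by rewrite lact_linearr hu hv scaler0 addr0.
- rewrite -[LHS](subrK (lact x (lact (loop (H4c F) 0) u))) -lact_lie hu linear0 addr0.
  elim/affine_ind: x => [x y hx hy|x m|k].
  + by rewrite [lie _ _]affine_lieDr lactDl hx hy addr0.
  + apply: (@H4_loop_ind _ (fun x => lact (lie (loop (H4c F) 0) x) u = 0)).
    * by move=> k y z hy hz; rewrite lie_linearr lact_linearl hy hz scaler0 addr0.
    * by rewrite lie0r lact0l.
    * exact: lie_ca level _ _ _.
    * exact: lie_cb level _ _ _.
    * exact: lie_cc level _ _ _.
    * by rewrite (lie_cd level) mul0r if_same scale0r.
  + by rewrite [lie _ _]affine_lie_centralr lact0l.
- rewrite lact_loop_top //= -(linear0 (ind_top (ge0_incl (H4 F)) (W := ge0_mod (H4_char dd) l))).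
  by congr (ind_top _ _); rewrite /H4_char_act mxE /= mulr0 mul0r.
Qed.

Lemma b0_top w : b0 (top w) = 0.
Proof.
rewrite lact_loop_top //= -(linear0 (ind_top (ge0_incl (H4 F)) (W := ge0_mod (H4_char dd) l))).
by congr (ind_top _ _); rewrite /H4_char_act mxE /= mulr0 mul0r.
Qed.

Local Notation T := (sugawara (M := V) l).

Let T_linear : linear T := sugawara_linear l (@smooth _ _ _ _).

Lemma sugawara_homog n (u : V) : homog n u -> T u = (n%:~R * l) *: u.
Proof.
elim=> {n u} [w|n|n k u v _ hu _ hv|n x m v _ hv|n v _ hv].
- rewrite mul0r scale0r; apply: sugawara_singular; first exact: c0_act_eq0.
    by move=> x n n0; rewrite lact_loop_top ?ltW // gt_eqF.
  exact: b0_top.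
- by rewrite sugawara0 ?scaler0 //; exact: smooth.
- by rewrite T_linear hu hv scalerDr !scalerA mulrC.
- rewrite -[LHS](subrK (lact (loop x m) (T v))).
  rewrite (sugawara_comm level (@smooth _ _ _ _) l_neq0) hv lactZr -scalerDl.
  by congr (_ *: _); rewrite rmorphB; ring.
- rewrite level; have := T_linear l v 0; rewrite sugawara0 ?addr0; last exact: smooth.
  by move=> ->; rewrite hv !scalerA mulrC.
Qed.

(** The adjoint action of b_0 on loop modes is nilpotent: it sends d to b, a to -c, and kills b and
    c. Local nilpotency thus passes from the top to the whole module. *)
Lemma b0_nilpotent (u : V) : exists i, iter i b0 u = 0.
Proof.
have iter_lin i k v w : iter i b0 (k *: v + w) = k *: iter i b0 v + iter i b0 w.
  by elim: i => // i IH; rewrite !iterS IH lact_linearr.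
have iter0 i : iter i b0 0 = 0 by elim: i => // i IH; rewrite iterS IH linear0.
have nil_lin k v w : (exists i, iter i b0 v = 0) -> (exists i, iter i b0 w = 0) ->
    exists i, iter i b0 (k *: v + w) = 0.
  move=> [i vi] [j wj]; exists (i + j)%N.
  by rewrite iter_lin addnC {1}iterD vi addnC iterD wj !iter0 scaler0 addr0.
have nilZ k v : (exists i, iter i b0 v = 0) -> exists i, iter i b0 (k *: v) = 0.
  by move=> vn; rewrite -[_ *: v]addr0; apply: nil_lin => //; exists 0%N.
have nilD v w : (exists i, iter i b0 v = 0) -> (exists i, iter i b0 w = 0) ->
    exists i, iter i b0 (v + w) = 0.
  by move=> vn wn; rewrite -[v]scale1r; exact: nil_lin.
have nilS v : (exists i, iter i b0 (b0 v) = 0) -> exists i, iter i b0 v = 0.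
  by case=> i vi; exists i.+1; rewrite iterSr.
have comm x v : (forall w, b0 (lact x w) = lact x (b0 w)) ->
    (exists i, iter i b0 v = 0) -> exists i, iter i b0 (lact x v) = 0.
  move=> xb [i vi]; exists i; rewrite (_ : iter _ _ _ = lact x (iter i b0 v)).
    by rewrite vi linear0.
  by elim: {vi} i => // i IH; rewrite !iterS IH xb.
have commB m v : b0 (lact (loop (H4b F) m) v) = lact (loop (H4b F) m) (b0 v).
  exact: lact_commute (lie_bb level _ _ _).
have commC m v : b0 (lact (loop (H4c F) m) v) = lact (loop (H4c F) m) (b0 v).
  exact: lact_commute (lie_bc level _ _ _).
have ad x v : b0 (lact x v) = lact x (b0 v) + lact (lie (loop (H4b F) 0) x) v.
  by rewrite lact_lie addrC subrK.
elim/ind_generated: u => [k u v|x u|w]; [exact: nil_lin| |by exists 1%N; exact: b0_top].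
move: x u; apply: (lact_submod level) => // x m u un.
move: x; apply: (@H4_loop_ind _ (fun x => exists i, iter i b0 (lact x u) = 0)).
- by move=> k x y xn yn; rewrite lact_linearl; exact: nil_lin.
- by exists 0%N; rewrite lact0l.
(* Applying b_0 to a_m u gives a_m b_0 u - c_m u: the first vector has a smaller nilpotency index
   inside, and c_m commutes with b_0. *)
- case: un => i; elim: i u => [|i IH] u ui.
    by exists 0%N; rewrite (ui : u = 0) linear0.
  apply: nilS; rewrite ad (lie_ba level) mul0r if_same scale0r addr0 -scaleN1r.
  apply: nilD; first by apply: IH; rewrite -iterSr.
  by apply/nilZ/comm; [exact: commC|exists i.+1].
- exact: comm.
- exact: comm.
- case: un => i; elim: i u => [|i IH] u ui.
    by exists 0%N; rewrite (ui : u = 0) linear0.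
  apply: nilS; rewrite ad (lie_bd level).
  apply: nilD; first by apply: IH; rewrite -iterSr.
  by apply/comm; [exact: commB|exists i.+1].
Qed.

Definition singular (u : V) := forall x n, 0 < n -> lact (loop x n) u = 0.

Variable N : submodule V.

(** As long as some positive mode does not kill the vector, applying it lowers a strict upper bound
    [K] on its degrees; a vector with [K = 0] vanishes, so this stops. *)
Lemma singular_exists (u : V) : N u -> u != 0 -> exists v, [/\ N v, v != 0 & singular v].
Proof.
pose deg K (u : V) := exists w : int -> V,
  [/\ fin_supp w, forall n, homog n (w n), forall n, K%:Z <= n -> w n = 0 & u = isum w].
suff H K v : deg K v -> N v -> v != 0 -> exists v, [/\ N v, v != 0 & singular v].
  have [w [[K wK] hw ->]] := homog_decomp u.
  apply: (H K.+1); exists w; split=> //; first by exists K.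
  by move=> n nK; apply: wK; lia.
elim: K v => [|K IH] v [w [fw hw wK ->]] Nv v0.
  move: v0; rewrite isum0 ?eqxx // => n.
  by have [/wK|n0] := lerP 0 n; last exact: homog_lt0 (hw n) n0.
have [sing|] := pselect (singular (isum w)); first by exists (isum w).
move=> /existsNP [x] /existsNP [n] /not_implyP [n0 xv].
apply: (IH (lact (loop x n) (isum w))); last exact/eqP.
  exists (fun j => lact (loop x n) (w (j + n))); split.
  - exact/fin_supp_lact/fin_supp_shift.
  - by move=> j; have := homog_loop x n (hw (j + n)); rewrite addrK.
  - by move=> j jK; rewrite wK ?linear0 //; lia.
  - by rewrite isum_lact ?isum_shift //; exact: fin_supp_shift.
exact: submod_lact.
Qed.

Lemma b0_singular u : singular u -> singular (b0 u).
Proof.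
move=> us x n n0; rewrite (lact_loopC level) us // linear0 add0r addr0.
by rewrite us // gt_eqF // scale0r addr0.
Qed.

(** Take the last nonzero iterate of b_0: brackets of b_0 with positive modes are positive modes, so
    the iterates stay singular. *)
Lemma singular_b0_exists (u : V) : N u -> u != 0 -> singular u ->
  exists v, [/\ N v, v != 0, singular v & b0 v = 0].
Proof.
case: (b0_nilpotent u) => i; elim: i u => [|i IH] u.
  by move=> /= ->; rewrite eqxx.
rewrite iterSr => bi Nu u0 us; have [b0u|b0u] := eqVneq (b0 u) 0; first by exists u.
by apply: (IH (b0 u)) => //; [exact: submod_lact|exact: b0_singular].
Qed.

Lemma submod_full (u : V) : N u -> u != 0 -> forall v, N v.
Proof.
move=> Nu u0; have [u1 [Nu1 u10 u1s]] := singular_exists Nu u0.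
have [u2 [Nu2 u20 u2s bu2]] := singular_b0_exists Nu1 u10 u1s.
have Tu2 : T u2 = 0 by apply: sugawara_singular => //; exact: c0_act_eq0.
have [w [fw hw u2w]] := homog_decomp u2.
have Tw (n : int) : T (w n) = (n%:~R * l) *: w n := sugawara_homog (hw n).
have fTw : fin_supp (fun n => (n%:~R * l) *: w n).
  by case: fw => K wK; exists K => n nK; rewrite wK ?scaler0.
have w0 n : n != 0 -> w n = 0.
  move=> n0; suff /eqP : (n%:~R * l) *: w n = 0.
    by rewrite scaler_eq0 mulf_eq0 intr_eq0 (negPf n0) (negPf l_neq0) => /eqP.
  (* Independence is applied to the scaled components n l w_n, whose sum is T u2 = 0. *)
  apply: (@eigen_isum_eq0 _ _ T l T_linear l_neq0 (fun n => (n%:~R * l) *: w n) fTw _ _ n).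
    move=> k; have := T_linear (k%:~R * l) (w k) 0.
    by rewrite sugawara0 ?addr0 => [->|]; [rewrite Tw|exact: smooth].
  by rewrite -[RHS]Tu2 u2w (linear_isum T_linear fw); apply: eq_isum => k; rewrite Tw.
move: Nu2 u20; rewrite u2w (@isum_single _ _ 0) //.
have [c ->] := homog0_top (hw 0) => Nc c0.
apply: (top_generates (c := c)) => //.
by apply: contraNneq c0 => ->; rewrite linear0.
Qed.
End LevelNonzero.

(** * Free field realization *)

Section FreeFields.
Variables (F : numFieldType) (l : F) (M : lmodType F).
Variables (be ga cc hh : int -> M -> M).
Hypotheses (be_lin : forall n, linear (be n)) (ga_lin : forall n, linear (ga n)).
Hypotheses (cc_lin : forall n, linear (cc n)) (hh_lin : forall n, linear (hh n)).
Hypothesis be_be : forall m n u, be m (be n u) = be n (be m u).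
Hypothesis ga_ga : forall m n u, ga m (ga n u) = ga n (ga m u).
Hypothesis be_ga : forall m n u, be m (ga n u) = ga n (be m u) + (m + n == 0)%:R *: u.
Hypothesis cc_cc : forall m n u, cc m (cc n u) = cc n (cc m u).
Hypothesis hh_hh : forall m n u, hh m (hh n u) = hh n (hh m u).
Hypothesis hh_cc : forall m n u,
  hh m (cc n u) = cc n (hh m u) + ((m + n == 0)%:R * (m%:~R * l)) *: u.
Hypothesis be_cc : forall m n u, be m (cc n u) = cc n (be m u).
Hypothesis be_hh : forall m n u, be m (hh n u) = hh n (be m u).
Hypothesis ga_cc : forall m n u, ga m (cc n u) = cc n (ga m u).
Hypothesis ga_hh : forall m n u, ga m (hh n u) = hh n (ga m u).
Hypothesis fields_smooth : forall u, exists N, forall n : int, N%:Z < n ->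
  [/\ be n u = 0, ga n u = 0 & cc n u = 0].
Hypothesis l_neq0 : l != 0.
Implicit Types (u v : M) (m n j : int).

Let lin0 (f : M -> M) : linear f -> f 0 = 0.
Proof. by move=> f_lin; have := f_lin (-1) 0 0; rewrite scaler0 addr0 scaleN1r addNr. Qed.
Let linD (f : M -> M) u v : linear f -> f (u + v) = f u + f v.
Proof. by move=> f_lin; have := f_lin 1 u v; rewrite !scale1r. Qed.
Let linZ (f : M -> M) k u : linear f -> f (k *: u) = k *: f u.
Proof. by move=> f_lin; have := f_lin k u 0; rewrite (lin0 f_lin) !addr0. Qed.
Let linN (f : M -> M) u : linear f -> f (- u) = - f u.
Proof. by move=> f_lin; rewrite -!scaleN1r (linZ _ _ f_lin). Qed.

Definition gacc n u : M := isum (fun j => ga j (cc (n - j) u)).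

(** The test is strict because ga_0 is a creation operator: the vacuum is killed by be_n for n >= 0
    but by ga_n only for n > 0. *)
Definition nprod n j u : M :=
  if 0 < j then be (n - j) (ga j u) else ga j (be (n - j) u).

Definition gabe n u : M := isum (fun j => nprod n j u).

Lemma gacc_fin n u : fin_supp (fun j => ga j (cc (n - j) u)).
Proof.
have [N uN] := fields_smooth u; exists (N + `|n|)%N => j jN.
have [j0|j0] := lerP 0 j.
  by rewrite ga_cc; have [|_ -> _] := uN j; rewrite ?(lin0 (cc_lin _)) //; lia.
by have [|_ _ ->] := uN (n - j); rewrite ?(lin0 (ga_lin _)) //; lia.
Qed.

Lemma nprod_fin n u : fin_supp (fun j => nprod n j u).
Proof.
have [N uN] := fields_smooth u; exists (N + `|n|)%N => j jN; rewrite /nprod.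
case: ifP => j0.
  by have [|_ -> _] := uN j; rewrite ?(lin0 (be_lin _)) //; lia.
by have [|-> _ _] := uN (n - j); rewrite ?(lin0 (ga_lin _)) //; lia.
Qed.

Lemma nprod_linear n j : linear (nprod n j).
Proof.
by move=> k u v; rewrite /nprod; case: ifP => _; rewrite ?ga_lin ?be_lin ?ga_lin.
Qed.

Lemma isum_linear (f : int -> M -> M) : (forall j, linear (f j)) ->
  (forall u, fin_supp (f^~ u)) -> linear (fun u => isum (f^~ u)).
Proof.
move=> f_lin f_fin k u v; rewrite -isum_scale // -isum_add //.
  by apply: eq_isum => j; exact: f_lin.
by have [N fN] := f_fin u; exists N => j /fN ->; rewrite scaler0.
Qed.

Lemma gacc_linear n : linear (gacc n).
Proof.
apply: (@isum_linear (fun j u => ga j (cc (n - j) u))) => [j k u v|u].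
  by rewrite cc_lin ga_lin.
exact: gacc_fin.
Qed.

Lemma gabe_linear n : linear (gabe n).
Proof. exact: isum_linear (nprod_linear n) (nprod_fin n). Qed.

Let delta_fin m (f : int -> F) (g : int -> M) :
  (forall j, j != m -> f j = 0) -> fin_supp (fun j => f j *: g j).
Proof. by move=> f0; apply: (@fin_supp_single _ _ m) => j /f0 ->; rewrite scale0r. Qed.

Let isum_delta m (f : int -> F) (g : int -> M) :
  (forall j, j != m -> f j = 0) -> isum (fun j => f j *: g j) = f m *: g m.
Proof. by move=> f0; rewrite (@isum_single _ _ m) // => j /f0 ->; rewrite scale0r. Qed.

Let d0 (p : bool) : (p = false) -> (p%:R : F) = 0. Proof. by move=> ->. Qed.

Lemma be_gacc m n u : be m (gacc n u) = gacc n (be m u) + cc (m + n) u.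
Proof.
rewrite (linear_isum (be_lin m) (gacc_fin n u)).
rewrite (eq_isum (g := fun j => ga j (cc (n - j) (be m u))
  + (m + j == 0)%:R *: cc (n - j) u)); last by move=> j; rewrite be_ga be_cc.
have f0 j : j != - m -> ((m + j == 0)%:R : F) = 0.
  by move=> jm; apply: d0; apply/negbTE; lia.
rewrite isum_add; [|exact: gacc_fin|exact: delta_fin f0].
by rewrite (isum_delta _ f0) subrr eqxx scale1r opprK addrC [n + m]addrC addrC.
Qed.

Lemma ga_gacc m n u : ga m (gacc n u) = gacc n (ga m u).
Proof.
rewrite (linear_isum (ga_lin m) (gacc_fin n u)); apply: eq_isum => j.
by rewrite ga_ga ga_cc.
Qed.

Lemma cc_gacc m n u : cc m (gacc n u) = gacc n (cc m u).
Proof.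
rewrite (linear_isum (cc_lin m) (gacc_fin n u)); apply: eq_isum => j.
by rewrite -ga_cc cc_cc.
Qed.

Lemma hh_gacc m n u : hh m (gacc n u) = gacc n (hh m u) + (m%:~R * l) *: ga (m + n) u.
Proof.
rewrite (linear_isum (hh_lin m) (gacc_fin n u)).
rewrite (eq_isum (g := fun j => ga j (cc (n - j) (hh m u))
  + ((m + (n - j) == 0)%:R * (m%:~R * l)) *: ga j u)); last first.
  by move=> j; rewrite -ga_hh hh_cc (linD _ _ (ga_lin _)) (linZ _ _ (ga_lin _)).
have f0 j : j != m + n -> ((m + (n - j) == 0)%:R * (m%:~R * l) : F) = 0.
  by move=> jm; rewrite d0 ?mul0r //; apply/negbTE; lia.
rewrite isum_add; [|exact: gacc_fin|exact: delta_fin f0].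
by rewrite (isum_delta _ f0) addrA subrr eqxx mul1r.
Qed.

Lemma gacc_gacc m n u : gacc m (gacc n u) = gacc n (gacc m u).
Proof.
rewrite (linear_isum (gacc_linear m) (gacc_fin n u)); apply: eq_isum => j.
by rewrite -ga_gacc cc_gacc.
Qed.

Lemma gabe_ga m n u : gabe m (ga n u) = ga n (gabe m u) + ga (m + n) u.
Proof.
rewrite (linear_isum (ga_lin n) (nprod_fin m u)).
have f0 j : j != m + n -> ((m - j + n == 0)%:R : F) = 0.
  by move=> jm; apply: d0; apply/negbTE; lia.
have <- : isum (fun j => (m - j + n == 0)%:R *: ga j u) = ga (m + n) u.
  by rewrite (isum_delta _ f0) opprD addrA subrr sub0r addNr eqxx scale1r.
rewrite -isum_add; last exact: delta_fin f0.
  apply: eq_isum => j; rewrite /nprod; case: ifP => _.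
    by rewrite ga_ga be_ga.
  by rewrite be_ga (linD _ _ (ga_lin _)) (linZ _ _ (ga_lin _)) ga_ga.
have [N uN] := nprod_fin m u; exists N => j /uN ->.
exact: lin0 (ga_lin n).
Qed.

Lemma gabe_be m n u : gabe m (be n u) = be n (gabe m u) - be (m + n) u.
Proof.
apply/(canRL (addrK _)); rewrite (linear_isum (be_lin n) (nprod_fin m u)).
have f0 j : j != - n -> ((n + j == 0)%:R : F) = 0.
  by move=> jm; apply: d0; apply/negbTE; lia.
have <- : isum (fun j => (n + j == 0)%:R *: be (m - j) u) = be (m + n) u.
  by rewrite (isum_delta _ f0) opprK subrr eqxx scale1r.
rewrite -isum_add; [|exact: nprod_fin|exact: delta_fin f0].
apply: eq_isum => j; rewrite /nprod; case: ifP => _.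
  by rewrite be_be (be_ga n) (linD _ _ (be_lin _)) (linZ _ _ (be_lin _)).
by rewrite be_be (be_ga n).
Qed.

Lemma gabe_commute (f : M -> M) m u : linear f ->
  (forall n v, be n (f v) = f (be n v)) -> (forall n v, ga n (f v) = f (ga n v)) ->
  gabe m (f u) = f (gabe m u).
Proof.
move=> f_lin bf gf; rewrite (linear_isum f_lin (nprod_fin m u)).
by apply: eq_isum => j; rewrite /nprod; case: ifP => _; rewrite ?bf ?gf ?bf.
Qed.

Lemma gabe_cc m n u : gabe m (cc n u) = cc n (gabe m u).
Proof. exact: gabe_commute (cc_lin n) _ _. Qed.

Lemma gabe_hh m n u : gabe m (hh n u) = hh n (gabe m u).
Proof. exact: gabe_commute (hh_lin n) _ _. Qed.

Lemma gabe_gacc m n u : gabe m (gacc n u) = gacc n (gabe m u) + gacc (m + n) u.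
Proof.
rewrite (linear_isum (gabe_linear m) (gacc_fin n u)).
rewrite (eq_isum (g := fun j => ga j (cc (n - j) (gabe m u))
  + ga (j + m) (cc (m + n - (j + m)) u))).
  rewrite isum_add ?(isum_shift (fun j => ga j (cc (m + n - j) u))) //.
    exact: gacc_fin.
  exact: (fin_supp_shift m (gacc_fin (m + n) u)).
move=> j; rewrite gabe_ga gabe_cc; congr (_ + ga _ (cc _ _)); lia.
Qed.

(** The quadratic parts agree up to moving the ordering point from 0 to m, which costs -m times the
    commutator of be and ga. This is the central term that the c-correction in [wak_d] must
    absorb. *)
Lemma gabe_gabe m n u :
  gabe m (gabe n u) = gabe n (gabe m u) - ((m + n == 0)%:R * m%:~R) *: u.
Proof.
pose E p j := if p < j then be (m + n - j) (ga j u) else ga j (be (m + n - j) u).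
have fE p : fin_supp (E p).
  have [N uN] := fields_smooth u; exists (N + `|m| + `|n| + `|p|)%N => j jN; rewrite /E.
  case: ifP => j0.
    by have [|_ -> _] := uN j; rewrite ?(lin0 (be_lin _)) //; lia.
  by have [|-> _ _] := uN (m + n - j); rewrite ?(lin0 (ga_lin _)) //; lia.
rewrite (linear_isum (gabe_linear m) (nprod_fin n u)).
rewrite (eq_isum (g := fun j => nprod n j (gabe m u) + (E m (j + m) - E 0 j))); last first.
  move=> j; have jm : n - j = m + n - (j + m) by lia.
  have mj : (m < j + m) = (0 < j) by lia.
  rewrite /nprod /E mj; case: ifP => _.
    rewrite gabe_be gabe_ga (linD _ _ (be_lin _)) -jm [m + j]addrC -addrA.
    by rewrite [m + (n - j)]addrA.
  rewrite gabe_ga gabe_be (linD _ _ (ga_lin _)) (linN _ (ga_lin _)) -jm [m + j]addrC.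
  by rewrite -addrA [- _ + _]addrC [m + (n - j)]addrA.
rewrite isum_add; [|exact: nprod_fin|]; last first.
  by apply: fin_suppD; [exact: fin_supp_shift|exact: fin_supp_opp].
congr (_ + _); rewrite isum_sub //; last exact: fin_supp_shift.
rewrite isum_shift -isum_sub //.
have [fs fE0] := isum_step F m.
rewrite -scaleNr mulrC -mulNr -fE0 -scalerA -isum_scalel // -[RHS](isum_shift _ (-1)).
apply: eq_isum => j; rewrite /E.
have -> : (m <= j - 1) = (m < j) by lia.
have -> : (0 <= j - 1) = (0 < j) by lia.
have bg : be (m + n - j) (ga j u) - ga j (be (m + n - j) u) = (m + n == 0)%:R *: u.
  by rewrite be_ga subrK addrC addKr.
case: ifP => _; case: ifP => _; rewrite ?subrr ?subr0 ?sub0r ?scale0r ?scale1r //.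
by rewrite scaleN1r -bg opprB.
Qed.
Let addrK1 (V : zmodType) (x y : V) : x + y - x = y.
Proof. by rewrite addrC addKr. Qed.

(* With x(z) the sum of the x_n z^-n, a Wakimoto-type realization: a = beta, c = c,
   b = gamma c + l z gamma' and d = h + c / 2l - :gamma beta:. The term c / 2l
   compensates the central term of the commutators of the modes of :gamma beta:. *)
Definition wak_b n u : M := gacc n u - (n%:~R * l) *: ga n u.
Definition wak_d n u : M := hh n u + (2 * l)^-1 *: cc n u - gabe n u.

Lemma wak_b_linear n : linear (wak_b n).
Proof.
move=> k u v; rewrite /wak_b gacc_linear ga_lin scalerDr scalerBr opprD addrACA.
by rewrite !scalerA [k * _]mulrC.
Qed.

Lemma wak_d_linear n : linear (wak_d n).
Proof.
move=> k u v; rewrite /wak_d gabe_linear hh_lin cc_lin scalerBr !scalerDr opprD.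
by rewrite !scalerA [k * _]mulrC (addrACA (k *: hh n u)) (addrACA (k *: hh n u + _)).
Qed.

Lemma be_wak_b m n u :
  be m (wak_b n u) = wak_b n (be m u) + (cc (m + n) u + ((m + n == 0)%:R * (m%:~R * l)) *: u).
Proof.
rewrite /wak_b (linD _ _ (be_lin m)) (linN _ (be_lin m)) (linZ _ _ (be_lin m)).
rewrite be_gacc be_ga scalerDr opprD addrACA; congr (_ + (_ + _)).
rewrite scalerA -scaleNr; congr (_ *: _); case: eqP => [mn|_]; last by rewrite mulr0 mul0r oppr0.
have -> : m = - n by lia.
by rewrite mulr1 mul1r rmorphN mulNr.
Qed.

Lemma wak_b_commute (f : M -> M) n u : linear f -> (forall v, f (gacc n v) = gacc n (f v)) ->
  (forall v, f (ga n v) = ga n (f v)) -> f (wak_b n u) = wak_b n (f u).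
Proof.
by move=> fl fg fgg; rewrite /wak_b (linD _ _ fl) (linN _ fl) (linZ _ _ fl) fg fgg.
Qed.

Lemma cc_wak_b m n u : cc m (wak_b n u) = wak_b n (cc m u).
Proof. by apply: wak_b_commute => [//|v|v]; [exact: cc_gacc|rewrite ga_cc]. Qed.

Lemma wak_b_wak_b m n u : wak_b m (wak_b n u) = wak_b n (wak_b m u).
Proof.
apply: wak_b_commute => [|v|v]; first exact: wak_b_linear.
- apply/esym/(@wak_b_commute (gacc n)); first exact: gacc_linear.
    by move=> w; exact: gacc_gacc.
  by move=> w; rewrite ga_gacc.
- apply/esym/(@wak_b_commute (ga n)); first exact: ga_lin.
    by move=> w; exact: ga_gacc.
  by move=> w; exact: ga_ga.
Qed.

Lemma wak_d_comm (f : M -> M) m u : linear f -> wak_d m (f u) = f (wak_d m u)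
  + ((hh m (f u) - f (hh m u)) + (2 * l)^-1 *: (cc m (f u) - f (cc m u))
     - (gabe m (f u) - f (gabe m u))).
Proof.
move=> fl; rewrite /wak_d !(linD _ _ fl) (linN _ fl) (linZ _ _ fl) scalerBr.
apply/eqP; rewrite [X in _ == X]addrC -subr_eq; apply/eqP.
by rewrite !opprD !opprK addrACA (addrACA (hh m (f u))).
Qed.

Lemma wak_d_be m n u : wak_d m (be n u) = be n (wak_d m u) + be (m + n) u.
Proof.
rewrite wak_d_comm // -be_hh -be_cc !subrr scaler0 addr0 add0r gabe_be.
by rewrite addrK1 opprK.
Qed.

Lemma wak_d_cc m n u :
  wak_d m (cc n u) = cc n (wak_d m u) + ((m + n == 0)%:R * (m%:~R * l)) *: u.
Proof.
by rewrite wak_d_comm // cc_cc gabe_cc !subrr scaler0 addr0 subr0 hh_cc addrK1.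
Qed.

Lemma wak_d_ga m n u : wak_d m (ga n u) = ga n (wak_d m u) - ga (m + n) u.
Proof.
by rewrite wak_d_comm // -ga_hh -ga_cc !subrr scaler0 addr0 add0r gabe_ga addrK1.
Qed.

Lemma wak_d_gacc m n u : wak_d m (gacc n u) = gacc n (wak_d m u)
  + ((m%:~R * l) *: ga (m + n) u - gacc (m + n) u).
Proof.
rewrite wak_d_comm; last exact: gacc_linear.
by rewrite cc_gacc subrr scaler0 addr0 hh_gacc gabe_gacc !addrK1.
Qed.

Lemma wak_d_wak_b m n u : wak_d m (wak_b n u) = wak_b n (wak_d m u) - wak_b (m + n) u.
Proof.
have dl := wak_d_linear m.
rewrite /wak_b (linD _ _ dl) (linN _ dl) (linZ _ _ dl) wak_d_gacc wak_d_ga.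
rewrite scalerBr opprD opprK opprB addrACA; congr (_ + _).
by rewrite addrAC -scalerDl rmorphD mulrDl.
Qed.

Lemma wak_d_hh m n u : wak_d m (hh n u) = hh n (wak_d m u)
  - ((2 * l)^-1 * ((n + m == 0)%:R * (n%:~R * l))) *: u.
Proof.
rewrite wak_d_comm // hh_hh gabe_hh hh_cc !subrr subr0 add0r.
by rewrite opprD addrA subrr add0r scalerN scalerA.
Qed.

Lemma wak_d_gabe m n u : wak_d m (gabe n u) = gabe n (wak_d m u)
  + ((m + n == 0)%:R * m%:~R) *: u.
Proof.
rewrite wak_d_comm; last exact: gabe_linear.
by rewrite gabe_hh gabe_cc !subrr scaler0 add0r sub0r gabe_gabe addrK1 opprK.
Qed.

(** The two cross terms of h with c / 2l contribute m in total when m + n = 0, cancelling the -m of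
    [gabe_gabe]. *)
Lemma wak_d_wak_d m n u : wak_d m (wak_d n u) = wak_d n (wak_d m u).
Proof.
have dl := wak_d_linear m.
rewrite {2}/wak_d (linD _ _ dl) (linN _ dl) (linD _ _ dl) (linZ _ _ dl).
rewrite wak_d_hh wak_d_cc wak_d_gabe scalerDr opprD.
rewrite (addrACA (hh n _)) [LHS]addrACA -/(wak_d n (wak_d m u)).
rewrite scalerA -!scaleNr -!scalerDl -[RHS]addr0; congr (_ + _).
rewrite (_ : _ + _ = 0) ?scale0r // [n + m]addrC; case: eqP => [mn|_]; last first.
  by rewrite !mul0r !mulr0 !oppr0 !addr0.
have -> : n = - m by lia.
by rewrite rmorphN; field; rewrite l_neq0.
Qed.

Definition wak_loop (x : H4 F) m u : M :=
  x 0 ja *: be m u + x 0 jb *: wak_b m u + x 0 jc *: cc m u + x 0 jd *: wak_d m u.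

Definition wak_act (w : affine (H4 F)) u : M :=
  \sum_(m <- msupp w.1) wak_loop w.1@_m m u + (l * w.2) *: u.

Let add4 (a a' b b' c c' d d' : M) : (a + a') + (b + b') + (c + c') + (d + d')
  = (a + b + c + d) + (a' + b' + c' + d').
Proof. by rewrite (addrACA a) (addrACA (a + b)) (addrACA (a + b + c)). Qed.

Lemma wak_loop_linearl m u : linear (fun x : H4 F => wak_loop x m u).
Proof.
move=> k x y; rewrite /wak_loop !mxE !scalerDl !scalerDr !scalerA.
exact: add4.
Qed.

Lemma wak_loop_linearr x m : linear (wak_loop x m).
Proof.
move=> k u v; rewrite /wak_loop be_lin cc_lin wak_b_linear wak_d_linear.
rewrite !scalerDr !scalerA ![_ * k]mulrC.
exact: add4.
Qed.

Lemma wak_linearl u : linear (wak_act^~ u).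
Proof.
move=> k w z; rewrite /wak_act (sum_msupp_linear (wak_loop_linearl^~ u)).
by rewrite scalerDr addrACA mulrDr scalerDl mulrCA scalerA.
Qed.

Lemma wak_linearr w : linear (wak_act w).
Proof.
move=> k u v; rewrite /wak_act.
under eq_bigr do rewrite wak_loop_linearr.
rewrite big_split /= -scaler_sumr [k *: (_ + _)]scalerDr.
rewrite [(l * _) *: (_ + _)]scalerDr addrACA !scalerA.
by rewrite [k * _]mulrC.
Qed.

Lemma wak_act_loop x m u : wak_act (loop x m) u = wak_loop x m u.
Proof.
rewrite /wak_act /= mulr0 scale0r addr0 (sum_msuppU (G := fun m x => wak_loop x m u)) //.
by move=> k; rewrite /wak_loop !mxE !scale0r !addr0.
Qed.

Lemma wak_act_central k u : wak_act (k *: central (H4 F)) u = (l * k) *: u.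
Proof. by rewrite /wak_act /= scaler0 msupp0 big_seq_fset0 add0r [k *: 1]mulr1. Qed.

Lemma wak_act_basis m u :
  [/\ wak_act (loop (H4a F) m) u = be m u, wak_act (loop (H4b F) m) u = wak_b m u,
      wak_act (loop (H4c F) m) u = cc m u & wak_act (loop (H4d F) m) u = wak_d m u].
Proof.
by rewrite !wak_act_loop /wak_loop !mxE /= !scale0r !scale1r !addr0 !add0r.
Qed.

Definition wak_bracket (w z : affine (H4 F)) : Prop := forall u,
  wak_act (lie w z) u = wak_act w (wak_act z u) - wak_act z (wak_act w u).

Let wak_actN w u : wak_act (- w) u = - wak_act w u.
Proof.
have := wak_linearl u (-1) w 0; rewrite addr0 !scaleN1r => ->.
by rewrite -(scale0r (central (H4 F))) wak_act_central mulr0 scale0r addr0.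
Qed.

Lemma wak_bracket_sym w z : wak_bracket w z -> wak_bracket z w.
Proof.
by move=> wz u; rewrite lieC wak_actN wz opprB.
Qed.

Lemma wak_bracket_lin k w w' z :
  wak_bracket w z -> wak_bracket w' z -> wak_bracket (k *: w + w') z.
Proof.
move=> wz w'z u; rewrite lie_linearl !wak_linearl wz w'z wak_linearr.
by rewrite scalerBr [LHS]addrACA (opprD (k *: _)).
Qed.

Lemma wak_bracket_central k z : wak_bracket (k *: central (H4 F)) z.
Proof.
move=> u; rewrite [lie _ _]affine_lie_centrall !wak_act_central.
rewrite (linZ _ _ (wak_linearr z)) subrr.
by have := wak_act_central 0 u; rewrite !scale0r mulr0 scale0r.
Qed.

Lemma wak_act_lie_loop x y m n u : wak_act (lie (loop x m) (loop y n)) u =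
  wak_act (loop (lie x y) (m + n)) u
  + ((m + n == 0)%:R * (m%:~R * iform x y * l)) *: u.
Proof.
rewrite [lie _ _](affine_lie_loop x y m n).
have -> p q : wak_act (p + q) u = wak_act p u + wak_act q u.
  by have := wak_linearl u 1 p q; rewrite !scale1r.
rewrite wak_act_central; congr (_ + _ *: _).
by case: eqP; rewrite ?mul1r ?mul0r ?mulr0 // mulrC.
Qed.

Lemma wak_bracket_loop x y m n : wak_bracket (loop x m) (loop y n).
Proof.
have w0 u : wak_act 0 u = 0.
  by have := wak_act_central 0 u; rewrite !scale0r mulr0 scale0r.
have B0 z : wak_bracket 0 z.
  by move=> u; rewrite lie0l !w0 (lin0 (wak_linearr z)) subrr.
have := H4_brackets F; have := H4_forms F.
set a := H4a F; set b := H4b F; set c := H4c F; set d := H4d F.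
move=> [[fab fcd faa fbb fcc] [fdd fac fad fbc fbd]].
move=> [[lab lda ldb] [lcd lca lcb]].
have act0 k u : wak_act (loop (0 : H4 F) k) u = 0 by rewrite loop0 w0.
have ea k u : wak_act (loop a k) u = be k u by have [] := wak_act_basis k u.
have eb k u : wak_act (loop b k) u = wak_b k u by have [] := wak_act_basis k u.
have ec k u : wak_act (loop c k) u = cc k u by have [] := wak_act_basis k u.
have ed k u : wak_act (loop d k) u = wak_d k u by have [] := wak_act_basis k u.
have fz k l' u : ((k%:R * (l' * 0 * l)) *: u : M) = 0 by rewrite mulr0 mul0r mulr0 scale0r.
have fdc : iform d c = 1 by rewrite iformC.
have fda : iform d a = 0 by rewrite iformC.
have fdb : iform d b = 0 by rewrite iformC.
have fca : iform c a = 0 by rewrite iformC.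
have fcb : iform c b = 0 by rewrite iformC.
have ldc : lie d c = 0 by rewrite lieC lcd oppr0.
have B x' y' m' n' : wak_bracket (loop x' m') (loop y' n') ->
  wak_bracket (loop y' n') (loop x' m') by exact: wak_bracket_sym.
have Baa i j : wak_bracket (loop a i) (loop a j).
  by move=> u; rewrite wak_act_lie_loop lie_alt act0 faa fz !ea be_be subrr addr0.
have Bab i j : wak_bracket (loop a i) (loop b j).
  move=> u; rewrite wak_act_lie_loop lab fab mulr1 !ea !eb !ec be_wak_b.
  by rewrite addrK1.
have Bca i j : wak_bracket (loop c i) (loop a j).
  by move=> u; rewrite wak_act_lie_loop lca fca fz act0 !ec !ea be_cc subrr addr0.
have Bda i j : wak_bracket (loop d i) (loop a j).
  by move=> u; rewrite wak_act_lie_loop lda fda fz addr0 !ed !ea wak_d_be addrK1.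
have Bbb i j : wak_bracket (loop b i) (loop b j).
  by move=> u; rewrite wak_act_lie_loop lie_alt act0 fbb fz !eb wak_b_wak_b subrr addr0.
have Bcb i j : wak_bracket (loop c i) (loop b j).
  by move=> u; rewrite wak_act_lie_loop lcb fcb fz act0 !ec !eb cc_wak_b subrr addr0.
have Bdb i j : wak_bracket (loop d i) (loop b j).
  move=> u; rewrite wak_act_lie_loop ldb fdb fz addr0 loopN.
  by rewrite wak_actN !ed !eb wak_d_wak_b addrK1.
have Bcc i j : wak_bracket (loop c i) (loop c j).
  by move=> u; rewrite wak_act_lie_loop lie_alt act0 fcc fz !ec cc_cc subrr addr0.
have Bdc i j : wak_bracket (loop d i) (loop c j).
  move=> u; rewrite wak_act_lie_loop ldc fdc mulr1 act0 add0r !ec !ed wak_d_cc.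
  by rewrite addrK1.
have Bdd i j : wak_bracket (loop d i) (loop d j).
  by move=> u; rewrite wak_act_lie_loop lie_alt act0 fdd fz !ed wak_d_wak_d subrr addr0.
have ind z i : wak_bracket (loop a i) z -> wak_bracket (loop b i) z ->
    wak_bracket (loop c i) z -> wak_bracket (loop d i) z ->
    forall x', wak_bracket (loop x' i) z.
  move=> ha hb hc hd; apply: (@H4_loop_ind _ (wak_bracket^~ z)) => //.
  by move=> k v w; exact: wak_bracket_lin.
(* Linearity in each argument reduces to sixteen basis pairs; antisymmetry reduces them to the ten
   relations above. *)
by apply: (ind); apply/wak_bracket_sym/ind => //; exact: B.
Qed.

Lemma wak_lie w z : wak_bracket w z.
Proof.
have D p p' y : wak_bracket p y -> wak_bracket p' y -> wak_bracket (p + p') y.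
  by move=> h h'; rewrite -[p]scale1r; exact: wak_bracket_lin.
elim/affine_ind: w => [w w' h h'|x m|k]; [exact: D| |exact: wak_bracket_central].
apply: wak_bracket_sym.
elim/affine_ind: z => [z z' h h'|y n|k]; [exact: D| |exact: wak_bracket_central].
exact: wak_bracket_loop.
Qed.

Definition wak_mod : lieModule (affine (H4 F)) :=
  LieModule wak_linearl wak_linearr wak_lie.

Variables (dd : F) (vac : M).
Hypothesis be_vac : forall n, 0 <= n -> be n vac = 0.
Hypothesis ga_vac : forall n, 0 < n -> ga n vac = 0.
Hypothesis cc_vac : forall n, 0 <= n -> cc n vac = 0.
Hypothesis hh_vac : forall n, 0 < n -> hh n vac = 0.
Hypothesis hh0_vac : hh 0 vac = dd *: vac.

Lemma wak_b_vac n : 0 <= n -> wak_b n vac = 0.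
Proof.
move=> n0; rewrite /wak_b /gacc isum0 ?sub0r => [|j].
  (* ga_0 does not kill the vacuum, but its coefficient n l is 0. *)
  have [->|nn0] := eqVneq n 0; first by rewrite mul0r scale0r oppr0.
  by rewrite ga_vac ?scaler0 ?oppr0 //; lia.
have [j0|j0] := lerP j n; first by rewrite cc_vac ?(lin0 (ga_lin _)) //; lia.
by rewrite ga_cc ga_vac ?(lin0 (cc_lin _)) //; lia.
Qed.

Lemma wak_d_vac n : 0 <= n -> wak_d n vac = if n == 0 then dd *: vac else 0.
Proof.
move=> n0; rewrite /wak_d /gabe isum0 => [|j]; last first.
  rewrite /nprod; case: ltP => j0; first by rewrite ga_vac ?(lin0 (be_lin _)).
  by rewrite be_vac ?(lin0 (ga_lin _)) //; lia.
rewrite cc_vac // scaler0 addr0 subr0; case: eqP => [->//|nn0].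
by apply: hh_vac; lia.
Qed.

Lemma wak_loop_vac x m : 0 <= m ->
  wak_loop x m vac = if m == 0 then (dd * x 0 jd) *: vac else 0.
Proof.
move=> m0; rewrite /wak_loop be_vac // wak_b_vac // cc_vac // wak_d_vac //.
rewrite !scaler0 !add0r; case: eqP => _; last by rewrite scaler0.
by rewrite scalerA mulrC.
Qed.

Lemma wak_act_vac (w : affine (H4 F)) : w \in aff_ge0 (g := H4 F) ->
  wak_act w vac = (dd * w.1@_0 0 jd + l * w.2) *: vac.
Proof.
move=> /allP w0; rewrite scalerDl; congr (_ + _).
rewrite (eq_big_seq (fun m : int => if m == 0 then (dd * w.1@_0 0 jd) *: vac else 0)).
  have [w10|w10] := boolP (0 \in msupp w.1).
    rewrite (big_fsetD1 _ w10) /= big_seq big1 ?addr0 // => m.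
    by rewrite !inE => /andP[/negPf ->].
  rewrite (mcoeff_outdom w10) mxE mulr0 scale0r big_seq big1 // => m wm.
  by case: eqP => // m0; rewrite -m0 wm in w10.
by move=> m wm; rewrite wak_loop_vac; [case: eqP => // ->|exact: w0].
Qed.

Lemma wak_hom : exists h : {linear VhatH4 l dd -> M},
  h (ind_top (W := ge0_mod (H4_char dd) l) (ge0_incl (H4 F)) (1 : F^o)) = vac.
Proof.
pose phi (k : F^o) : M := k *: vac.
have phi_lin : linear phi by move=> k p q; rewrite /phi scalerDl scalerA.
pose H := GRing.isLinear.Build _ _ _ _ phi phi_lin.
pose Phi := HB.pack_for {linear ge0_mod (H4_char dd) l -> wak_mod} phi H.
have [|h [_ htop]] := @ind_hom _ _ _ (ge0_incl (H4 F))
  (ge0_mod (H4_char dd) l) wak_mod Phi.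
  move=> w k; rewrite /= /phi (linZ _ _ (wak_linearr _)).
  rewrite wak_act_vac ?scalerA; last exact: valP w.
  congr (_ *: _); rewrite /ge0_act /= /H4_char_act /GRing.scale /=.
  by rewrite mulrDr !(mulrC k).
by exists h; rewrite htop /= /phi scale1r.
Qed.
End FreeFields.

(** * A Fock space of functions with finite-difference oscillators *)

Section FockSpace.
Variable F : numFieldType.
Local Notation K := (bool * int)%type.
Implicit Types (k : K) (e : K -> F).

(* Creation and annihilation operators are realised as multiplication by e k with a
   shift and as a finite difference, so that no polynomials are needed and the
   vacuum is the constant function 1. *)
Definition bump_at k (x : F) e : K -> F := fun k' => e k' + x * (k' == k)%:R.
Definition fock_fun : Type := (K -> F) -> F^o.
HB.instance Definition _ := GRing.Lmodule.on fock_fun.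

Definition raise k (f : fock_fun) : fock_fun := fun e => e k * f (bump_at k (-1) e).
Definition lower k (f : fock_fun) : fock_fun := fun e => f (bump_at k 1 e) - f e.

Lemma bump_atC k k' x y e : bump_at k x (bump_at k' y e) = bump_at k' y (bump_at k x e).
Proof. by apply/funext => i; rewrite /bump_at addrAC. Qed.

Lemma bump_atK k x e : bump_at k (- x) (bump_at k x e) = e.
Proof. by apply/funext => i; rewrite /bump_at mulNr addrK. Qed.

Lemma raise_linear k : linear (raise k).
Proof. by move=> c f h; apply/funext => e; rewrite /raise mulrDr mulrCA. Qed.
Lemma lower_linear k : linear (lower k).
Proof.
move=> c f h; apply/funext => e; rewrite /lower opprD addrACA; congr (_ + _).
by rewrite -mulrBr.
Qed.

Lemma raise_raise k k' f : raise k (raise k' f) = raise k' (raise k f).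
Proof.
apply/funext => e; have [->//|kk'] := eqVneq k k'.
rewrite /raise /bump_at (negPf kk') [k' == k]eq_sym (negPf kk') !mulr0 !addr0 mulrCA.
by rewrite -!/(bump_at _ _ _) bump_atC.
Qed.

Lemma lower_lower k k' f : lower k (lower k' f) = lower k' (lower k f).
Proof.
apply/funext => e; rewrite /lower bump_atC !opprB.
by rewrite addrACA [RHS]addrACA [- _ - _]addrC.
Qed.

(** Canonical commutation relation as a discrete Leibniz rule: for equal labels, the increment 1 of
    the factor [e k] multiplies [f] at the point shifted forth and back, that is, at [e]. *)
Lemma lower_raise k k' f : lower k (raise k' f) = raise k' (lower k f) + (k == k')%:R *: f.
Proof.
apply/funext => e; rewrite -[RHS]/(raise k' (lower k f) e + (k == k')%:R * f e).
rewrite /lower /raise bump_atC {1}/bump_at mul1r mulrDl mulrBr addrAC eq_sym.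
congr (_ + _); case: eqP => [->|_]; last by rewrite !mul0r.
by rewrite bump_atC bump_atK.
Qed.

(** A general function may depend on infinitely many coordinates, so that infinitely many
    annihilators act nontrivially; the infinite mode sums need this restriction. *)
Definition fock_smooth : {pred fock_fun} :=
  fun f => `[< exists N, forall k, (N < `|k.2|)%N -> lower k f = 0 >].

Fact fock_smooth_submod : submod_closed fock_smooth.
Proof.
split=> [|c f h /asboolP[N fN] /asboolP[N' hN]]; apply/asboolP.
  exists 0%N => k _; have := lower_linear k (-1) 0 0.
  by rewrite scaler0 addr0 scaleN1r addNr.
exists (maxn N N') => k kN; rewrite lower_linear fN ?hN ?scaler0 ?addr0 //; lia.
Qed.
HB.instance Definition _ := GRing.isSubmodClosed.Build F fock_fun fock_smooth
  fock_smooth_submod.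

Record fock := Fock { fock_val :> fock_fun; _ : fock_val \in fock_smooth }.
HB.instance Definition _ := [isSub for fock_val].
HB.instance Definition _ := [Choice of fock by <:].
HB.instance Definition _ := [SubChoice_isSubLmodule of fock by <:].

Lemma raise_smooth k f : f \in fock_smooth -> raise k f \in fock_smooth.
Proof.
move=> /asboolP[N fN]; apply/asboolP; exists (maxn N `|k.2|) => k' k'N.
rewrite lower_raise fN; last by lia.
have -> : (k' == k) = false by apply: contraTF k'N => /eqP ->; lia.
rewrite scale0r addr0; have := raise_linear k (-1) 0 0.
by rewrite scaler0 addr0 scaleN1r addNr.
Qed.

Lemma lower_smooth k f : f \in fock_smooth -> lower k f \in fock_smooth.
Proof.
move=> /asboolP[N fN]; apply/asboolP; exists N => k' k'N.
rewrite lower_lower fN //; have := lower_linear k (-1) 0 0.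
by rewrite scaler0 addr0 scaleN1r addNr.
Qed.

Definition create k (u : fock) : fock := Fock (raise_smooth k (valP u)).
Definition annih k (u : fock) : fock := Fock (lower_smooth k (valP u)).

Lemma create_linear k : linear (create k).
Proof. by move=> c u v; apply: val_inj; exact: raise_linear. Qed.
Lemma annih_linear k : linear (annih k).
Proof. by move=> c u v; apply: val_inj; exact: lower_linear. Qed.
Lemma create_create k k' u : create k (create k' u) = create k' (create k u).
Proof. by apply: val_inj; exact: raise_raise. Qed.
Lemma annih_annih k k' u : annih k (annih k' u) = annih k' (annih k u).
Proof. by apply: val_inj; exact: lower_lower. Qed.
Lemma annih_create k k' u : annih k (create k' u) = create k' (annih k u) + (k == k')%:R *: u.
Proof. by apply: val_inj; exact: lower_raise. Qed.
Lemma annih_smooth u : exists N, forall k, (N < `|k.2|)%N -> annih k u = 0.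
Proof.
have /asboolP[N uN] := valP u; exists N => k /uN k0.
exact: val_inj.
Qed.

Fact vacuum_smooth : (fun=> 1) \in fock_smooth.
Proof. by apply/asboolP; exists 0%N => k _; apply/funext => e; rewrite /lower subrr. Qed.
Definition vacuum : fock := Fock vacuum_smooth.

Lemma annih_vacuum k : annih k vacuum = 0.
Proof. by apply: val_inj; apply/funext => e; rewrite /= /lower subrr. Qed.
Lemma vacuum_neq0 : vacuum != 0.
Proof.
apply: contra_neq (oner_neq0 F) => /(congr1 (fun u : fock => fock_val u (fun=> 0))).
by [].
Qed.

Variables (l dd : F).

(** Labels with [true] serve the pair beta, gamma and those with [false] the pair h, c. Modes n and
    -n of the two partners share one oscillator; the minus sign in [fock_ga] and the factors n l on
    annihilators give the prescribed commutators. *)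
Definition fock_be n (u : fock) : fock :=
  if 0 <= n then annih (true, n) u else create (true, n) u.
Definition fock_ga n (u : fock) : fock :=
  if 0 < n then - annih (true, - n) u else create (true, - n) u.
Definition fock_cc n (u : fock) : fock :=
  if 0 < n then (n%:~R * l) *: annih (false, n) u
  else if n == 0 then 0 else create (false, n) u.
Definition fock_hh n (u : fock) : fock :=
  if 0 < n then (n%:~R * l) *: annih (false, - n) u
  else if n == 0 then dd *: u else create (false, - n) u.

Let linZ (h : fock -> fock) c u : linear h -> h (c *: u) = c *: h u.
Proof.
move=> hl; have h0 : h 0 = 0.
  by have := hl (-1) 0 0; rewrite scaler0 addr0 scaleN1r addNr.
by have := hl c u 0; rewrite h0 !addr0.
Qed.

Let aZ k c u : annih k (c *: u) = c *: annih k u.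
Proof. exact/linZ/annih_linear. Qed.
Let cZ k c u : create k (c *: u) = c *: create k u.
Proof. exact/linZ/create_linear. Qed.
Let aN k u : annih k (- u) = - annih k u.
Proof. by rewrite -!scaleN1r aZ. Qed.
Let cN k u : create k (- u) = - create k u.
Proof. by rewrite -!scaleN1r cZ. Qed.
Let a0 k : annih k 0 = 0.
Proof. by rewrite -(scale0r 0) aZ !scale0r. Qed.
Let c0 k : create k 0 = 0.
Proof. by rewrite -(scale0r 0) cZ !scale0r. Qed.
Let ac k k' u : k != k' -> annih k (create k' u) = create k' (annih k u).
Proof. by move=> /negPf kk; rewrite annih_create kk scale0r addr0. Qed.

Lemma fock_be_linear n : linear (fock_be n).
Proof.
by move=> c u v; rewrite /fock_be; case: ifP => _; rewrite ?annih_linear ?create_linear.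
Qed.
Lemma fock_ga_linear n : linear (fock_ga n).
Proof.
move=> c u v; rewrite /fock_ga; case: ifP => _; rewrite ?create_linear //.
by rewrite annih_linear opprD scalerN.
Qed.
Lemma fock_cc_linear n : linear (fock_cc n).
Proof.
move=> c u v; rewrite /fock_cc; do 2?case: ifP => _; rewrite ?create_linear //.
  by rewrite annih_linear scalerDr !scalerA mulrC.
by rewrite scaler0 addr0.
Qed.
Lemma fock_hh_linear n : linear (fock_hh n).
Proof.
move=> c u v; rewrite /fock_hh; do 2?case: ifP => _; rewrite ?create_linear //.
  by rewrite annih_linear scalerDr !scalerA mulrC.
by rewrite scalerDr !scalerA mulrC.
Qed.

Lemma fock_be_ga m n u :
  fock_be m (fock_ga n u) = fock_ga n (fock_be m u) + (m + n == 0)%:R *: u.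
Proof.
rewrite /fock_be /fock_ga; case: ifP => m0; case: ifP => n0.
- rewrite aN annih_annih (_ : _ == _ = false) ?scale0r ?addr0 //; lia.
- by rewrite annih_create xpair_eqE eqxx /= -addr_eq0.
- rewrite cN annih_create xpair_eqE eqxx /= opprD -addrA.
  have -> : (- n == m) = (m + n == 0) by lia.
  by rewrite addNr addr0.
- rewrite create_create (_ : _ == _ = false) ?scale0r ?addr0 //; lia.
Qed.

Lemma fock_hh_cc m n u : fock_hh m (fock_cc n u)
  = fock_cc n (fock_hh m u) + ((m + n == 0)%:R * (m%:~R * l)) *: u.
Proof.
have dz p (x : F) : p = false -> (p%:R * x) *: u = 0 by move=> ->; rewrite mul0r scale0r.
rewrite /fock_hh /fock_cc.
case: (ltgtP m 0) => [m0|m0|->]; case: (ltgtP n 0) => [n0|n0|->];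
  rewrite ?aZ ?cZ ?a0 ?c0 ?scaler0 ?eqxx ?mulr0z ?mul0r ?mulr0 ?scale0r ?addr0 //.
- rewrite create_create dz ?addr0 //; lia.
- rewrite annih_create xpair_eqE eqxx /= scalerDr -addrA scalerA -scalerDl.
  rewrite (_ : n%:~R * l * _ + _ = 0) ?scale0r ?addr0 //.
  have -> : (n == - m) = (m + n == 0) by lia.
  case: eqP => [mn|_]; last by rewrite !mulr0n; ring.
  have -> : n = - m by lia.
  by rewrite mulr1n rmorphN /=; ring.
- by rewrite dz ?addr0 //; apply/negbTE; lia.
- rewrite annih_create xpair_eqE eqxx /= scalerDr scalerA [_ * (_ == _)%:R]mulrC.
  by have -> : (- m == n) = (m + n == 0) by lia.
- rewrite annih_annih dz ?addr0 ?scalerA 1?mulrC //; lia.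
- by rewrite dz ?addr0 //; apply/negbTE; lia.
- by rewrite !scalerA mulrC.
Qed.

(** In the commutations treated here an annihilator never meets the creator with its own label, and
    [lia] checks that the labels differ. *)
Ltac fock_commute :=
  rewrite /fock_be /fock_ga /fock_cc /fock_hh; do ![case: ifP => ?];
  rewrite ?aZ ?cZ ?aN ?cN ?a0 ?c0 ?scaler0 ?oppr0 //;
  try match goal with
  | |- context [annih ?k (annih ?k' ?u)] => rewrite (annih_annih k k' u)
  | |- context [create ?k (create ?k' ?u)] => rewrite (create_create k k' u)
  | |- context [annih ?k (create ?k' ?u)] => rewrite (ac (k := k) (k' := k') u)
  end;
  rewrite ?scalerN // ?scalerA; try (by rewrite mulrC); rewrite ?xpair_eqE /=; lia.

Lemma fock_be_be m n u : fock_be m (fock_be n u) = fock_be n (fock_be m u).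
Proof. fock_commute. Qed.
Lemma fock_ga_ga m n u : fock_ga m (fock_ga n u) = fock_ga n (fock_ga m u).
Proof. fock_commute. Qed.
Lemma fock_cc_cc m n u : fock_cc m (fock_cc n u) = fock_cc n (fock_cc m u).
Proof. fock_commute. Qed.
Lemma fock_hh_hh m n u : fock_hh m (fock_hh n u) = fock_hh n (fock_hh m u).
Proof. fock_commute. Qed.
Lemma fock_be_cc m n u : fock_be m (fock_cc n u) = fock_cc n (fock_be m u).
Proof. fock_commute. Qed.
Lemma fock_be_hh m n u : fock_be m (fock_hh n u) = fock_hh n (fock_be m u).
Proof. fock_commute. Qed.
Lemma fock_ga_cc m n u : fock_ga m (fock_cc n u) = fock_cc n (fock_ga m u).
Proof. fock_commute. Qed.
Lemma fock_ga_hh m n u : fock_ga m (fock_hh n u) = fock_hh n (fock_ga m u).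
Proof. fock_commute. Qed.

Lemma fock_fields_smooth u : exists N, forall n : int, N%:Z < n ->
  [/\ fock_be n u = 0, fock_ga n u = 0 & fock_cc n u = 0].
Proof.
have [N uN] := annih_smooth u; exists N => n nN; rewrite /fock_be /fock_ga /fock_cc.
have n0 : 0 < n by lia.
by rewrite n0 (ltW n0) !uN ?oppr0 ?scaler0 //=; lia.
Qed.

Lemma fock_top_neq0 : l != 0 ->
  ind_top (W := ge0_mod (H4_char dd) l) (ge0_incl (H4 F)) (1 : F^o) != 0.
Proof.
move=> l0; have [|||||h hvac] := @wak_hom F l fock _ _ _ _
  fock_be_linear fock_ga_linear fock_cc_linear fock_hh_linear
  fock_be_be fock_ga_ga fock_be_ga fock_cc_cc fock_hh_hh fock_hh_cc
  fock_be_cc fock_be_hh fock_ga_cc fock_ga_hh fock_fields_smooth l0 dd vacuum.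
- by move=> n n0; rewrite /fock_be n0 annih_vacuum.
- by move=> n n0; rewrite /fock_ga n0 annih_vacuum oppr0.
- move=> n n0; rewrite /fock_cc; case: ltP => n1; first by rewrite annih_vacuum scaler0.
  by rewrite ifT //; lia.
- by move=> n n0; rewrite /fock_hh n0 annih_vacuum scaler0.
- by rewrite /fock_hh ltxx eqxx.
by apply: contra_neq vacuum_neq0 => t0; rewrite -hvac t0 linear0.
Qed.
End FockSpace.

(** * The irreducibility criterion *)

Lemma level_nonzero_irreducible (F : numFieldType) (l dd : F) :
  l != 0 -> irreducible (VhatH4 l dd).
Proof.
move=> l0; split; first by eexists; exact: fock_top_neq0 dd l0.
move=> N; have [[u [Nu u0]]|N0] := pselect (exists u, N u /\ u <> 0).
  right; apply/seteqP; split=> // v _.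
  by have /eqP u1 := u0; exact: (submod_full l0 Nu u1).
left; apply/seteqP; split=> [u Nu|u ->]; last exact: submod_set0.
by apply: contrapT => u0; apply: N0; exists u.
Qed.

Local Open Scope complex_scope.

Theorem theorem3p2 (R : realType) (l dd : R[i]) :
  (irreducible (VhatH4 l dd) <-> l != 0) /\
  (l = 0 ->
    exists J : submodule (VhatH4 l dd),
      [/\ largest_graded J,
          irreducible (quot_mod J) &
          lie_isomorphic (quot_mod J) (hatH4_char dd)]).
Proof.
split; last by move=> ->; exact: level0_quotient.
split=> [irr|]; last exact: level_nonzero_irreducible.
by apply/eqP => l0; move: irr; rewrite l0; exact: level0_reducible.
Qed.
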